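(* Let $\lambda$ be a Salem number, $\delta$ a non-real Galois conjugate of $\lambda$, $m\in\mathbb{N}$, and let $\boldsymbol{\alpha}=(\alpha_1,\alpha_2)=(\delta^{m/2}\alpha,\ \delta^{m/2}\alpha^{-1})$ with $\alpha\in\mathbb{C}^\times$, where the branch of $\delta^{1/2}$ is chosen so that $\delta^{1/2}$ is conjugate to the positive square root $\lambda^{1/2}$ of $\lambda$. Suppose that there is a rational function $\hat P(w)\in\mathbb{Q}(w)$, even if $m$ is even and odd if $m$ is odd, such that $\alpha+\alpha^{-1}=\hat P(\hat\tau)$ with $\hat\tau:=\delta^{1/2}+\delta^{-1/2}$, and let $Q(w)\in\mathbb{Q}(w)$ be the associated function defined in the context. Let $\rho:=\lambda+\lambda^{-1}$. (I) If $Q(\rho)\in[-2,2]$, then $\boldsymbol{\alpha}$ is MD exactly when there exists an integer $k\in\mathbb{N}$ such that $$\mathrm{CT}_k(Q(\rho))=0,\qquad \phi(k)\mid\deg\lambda .$$ In this case $\boldsymbol{\alpha}$ is NR. (II) If $Q(\rho)>2$, then $\boldsymbol{\alpha}$ is MD exactly when there exist a coprime pair $(j,k)\in\mathbb{N}^2$ and a Salem trace $\sigma$ such that $$H_j(\sigma)=Q(\rho),\qquad \rho=H_k(\sigma).$$ In this case, $(j,k)$ and $\sigma$ are unique, and $\boldsymbol{\alpha}$ is NR if and only if $(j,k)$ satisfies the conditions: (N1) $\Delta:=km-j\ge 2$; (N2) $\Delta$ does not divide $m$; (N3) if $\Delta$ is even, $\Delta$ divides $2m$ and $(2m)/\Delta$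 is odd, then $\hat P(\hat\rho)<0$, where $\hat\rho:=\lambda^{1/2}+\lambda^{-1/2}$ with $\lambda^{1/2}$ the positive square root of $\lambda$.
   Context: $\mathbb{N}=\mathbb{Z}_{\ge1}$. A Salem number is a real algebraic integer $\lambda>1$ conjugate to $\lambda^{-1}$ whose remaining conjugates have modulus $1$; its degree $\deg\lambda$ is an even integer $\ge4$. A Salem trace is a number $\mu+\mu^{-1}$ with $\mu$ a Salem number. A pair $(\alpha_1,\alpha_2)$ of nonzero complex numbers is multiplicatively independent (MI) if any relation $\alpha_1^{n_1}=\alpha_2^{n_2}$ with $(n_1,n_2)\in\mathbb{Z}^2$ implies $n_1=n_2=0$; otherwise it is multiplicatively dependent (MD). It is non-resonant (NR) if $\alpha_j\ne\alpha_1^{n_1}\alpha_2^{n_2}$ for $j=1,2$ and all integers $n_1,n_2\ge0$ with $n_1+n_2\ge2$. $H_n(w)\in\mathbb{Z}[w]$ ($n\ge 0$) is the polynomial with $H_n(z+z^{-1})=z^n+z^{-n}$; in particular $H_2(w)=w^2-2$. Definition of $Q$: by parity, $\hat P(w)=P(H_2(w))$ when $m$ is even and $\hat P(w)=w^{-1}P(H_2(w))$ when $m$ is odd, for a rational function $P(w)\in\mathbb{Q}(w)$. Put $Q(w):=P(w)^2-2$ when $m$ is even and $Q(w):=(w+2)^{-1}P(w)^2-2$ when $m$ is odd. (Then $\alpha^2+\alpha^{-2}=Q(\delta+\delta^{-1})$ and $Q(w)\ge-2$ for $w>-2$ away from poles.) For $k\ge3$, $\mathrm{CT}_k(w)$ is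 the trace polynomial of the $k$-th cyclotomic polynomial $\mathrm{C}_k(z)$, i.e. $\mathrm{C}_k(z)=z^{\phi(k)/2}\,\mathrm{CT}_k(z+z^{-1})$, with $\phi$ Euler's totient. For $k=1,2$ the following nonstandard convention is used: $\mathrm{CT}_1(w):=w-2$, $\mathrm{CT}_2(w):=w+2$, $\phi(1)=\phi(2)=2$. *)

(* Defs.v *)
From HB Require Import structures.
From mathcomp Require Import all_boot all_order all_algebra all_field.
From mathcomp Require Import generic_quotient boolp classical_sets reals.
From mathcomp Require Import complex.
From mathcomp Require Import ring.

Set Implicit Arguments.
Unset Strict Implicit.
Unset Printing Implicit Defensive.

Import Order.TTheory GRing.Theory Num.Theory.
Local Open Scope ring_scope.
Local Open Scope quotient_scope.

Definition is_minpoly (F : numFieldType) (x : F) (p : {poly rat}) : Prop :=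
  [/\ p \is monic, irreducible_poly p & root (map_poly ratr p) x].

(* [minpoly x = 0] (so [degQ x = 0]) when [x] is transcendental. *)
Definition minpoly (F : numFieldType) (x : F) : {poly rat} :=
  xget 0 (is_minpoly x).

Definition degQ (F : numFieldType) (x : F) : nat := (size (minpoly x)).-1.

Definition conjugate (F : numFieldType) (x y : F) : Prop :=
  exists2 p : {poly rat}, is_minpoly x p & root (map_poly ratr p) y.

(* The bound [4 <= degQ x] excludes quadratic units, for which there are no
   remaining conjugates; the evenness of the degree is then a consequence. *)
Definition is_salem (R : realType) (x : R) : Prop :=
  [/\ 1 < x,
      integralOver (intr : int -> R) x,
      conjugate (x%:C)%C (x^-1%:C)%C,
      forall z : R[i], conjugate (x%:C)%C z ->
        z <> (x%:C)%C -> z <> (x^-1%:C)%C -> `|z| = 1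
    & (4 <= degQ x)%N].

Definition is_salem_trace (R : realType) (s : R) : Prop :=
  exists2 mu : R, is_salem mu & s = mu + mu^-1.

Definition mult_indep (C : fieldType) (a1 a2 : C) : Prop :=
  forall n1 n2 : int, a1 ^ n1 = a2 ^ n2 -> n1 = 0 /\ n2 = 0.

Definition mult_dep (C : fieldType) (a1 a2 : C) : Prop := ~ mult_indep a1 a2.

Definition non_resonant (C : fieldType) (a1 a2 : C) : Prop :=
  forall n1 n2 : nat, (2 <= n1 + n2)%N ->
    a1 <> a1 ^+ n1 * a2 ^+ n2 /\ a2 <> a1 ^+ n1 * a2 ^+ n2.

(* The polynomials H_n; they are characterised by [Hpoly_spec] below. *)

Fixpoint Hpoly (n : nat) : {poly int} :=
  match n with
  | 0 => 2%:P
  | 1 => 'X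
  | (m.+1 as n').+1 => 'X * Hpoly n' - Hpoly m
  end.

(* Trace polynomial of a palindromic [f] of degree [2 * d]: pairing the terms of
   degree [d + i] and [d - i] gives
   f(z) = z^d * (f_d + sum_(1 <= i <= d) f_(d+i) * (z^i + z^-i)). *)
Definition trace_poly (f : {poly int}) : {poly int} :=
  let d := (size f).-1./2 in
  (f`_d)%:P + \sum_(1 <= i < d.+1) f`_(d + i) *: Hpoly i.

(* Meaningful for [0 < k]; for [2 < k] it is characterised by [CTpoly_spec]. *)
Definition CTpoly (k : nat) : {poly int} :=
  match k with
  | 1 => 'X - 2%:P
  | 2 => 'X + 2%:P
  | _ => trace_poly 'Phi_k
  end.

(* Euler's totient, except that phi(1) = phi(2) = 2. *)
Definition totient2 (k : nat) : nat := if (k <= 2)%N then 2 else totient k.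

Definition ratfun : Type := {fraction {poly rat}}.

(* The stored fraction need not be reduced, so it is reduced first: poles and
   values must not depend on the chosen representative. *)
Definition rnum (f : ratfun) : {poly rat} :=
  let r := repr f in \n_r %/ gcdp \n_r \d_r.
Definition rden (f : ratfun) : {poly rat} :=
  let r := repr f in \d_r %/ gcdp \n_r \d_r.

Definition regular_at (F : numFieldType) (f : ratfun) (x : F) : Prop :=
  ~~ root (map_poly ratr (rden f)) x.

(* Meaningful when [regular_at f x]; the value is 0 at a pole. *)
Definition reval (F : numFieldType) (f : ratfun) (x : F) : F :=
  (map_poly ratr (rnum f)).[x] / (map_poly ratr (rden f)).[x].

(* f(h(w)), for a nonconstant polynomial h *)
Definition rcomp (f : ratfun) (h : {poly rat}) : ratfun :=
  tofrac (rnum f \Po h) / tofrac (rden f \Po h).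

Definition even_ratfun (f : ratfun) : Prop := rcomp f (- 'X) = f.
Definition odd_ratfun (f : ratfun) : Prop := rcomp f (- 'X) = - f.

Definition H2Q : {poly rat} := map_poly intr (Hpoly 2).

(* Phat(w) = P(H_2(w)) for even m, Phat(w) = w^-1 * P(H_2(w)) for odd m; this
   determines P. *)
Definition is_associated (m : nat) (Phat P : ratfun) : Prop :=
  Phat = if odd m then (tofrac 'X)^-1 * rcomp P H2Q else rcomp P H2Q.

Definition Qfun (m : nat) (P : ratfun) : ratfun :=
  if odd m then (tofrac ('X + 2%:P))^-1 * P ^+ 2 - 2 else P ^+ 2 - 2.

Lemma Hpoly_spec (F : fieldType) (n : nat) (z : F) : z != 0 ->
  (map_poly intr (Hpoly n)).[z + z^-1] = z ^+ n + z ^- n.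
Proof.
move=> z0; elim/ltn_ind: n => -[|[|n]] IH.
- by rewrite /= map_polyC /= hornerC !expr0 invr1.
- by rewrite /= map_polyX hornerX !expr1.
have -> : Hpoly n.+2 = 'X * Hpoly n.+1 - Hpoly n by [].
rewrite rmorphB rmorphM /= map_polyX !hornerE (IH n.+1) // (IH n) //.
rewrite -!exprVn !exprS; have zV : z * z^-1 = 1 by rewrite divff.
set y := z^-1 in zV *; set a := z ^+ n; set b := y ^+ n.
rewrite mulrDl !mulrDr [z * (y * b)]mulrA zV mul1r.
by rewrite [y * (z * a)]mulrA [y * z]mulrC zV mul1r; ring.
Qed.

Lemma horner_rev (F : fieldType) (p : {poly int}) (t : nat) (x : F) :
    (size p <= t.+1)%N -> x != 0 ->
  (map_poly intr (\poly_(i < t.+1) p`_(t - i))).[x] =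
    x ^+ t * (map_poly intr p).[x^-1].
Proof.
move=> sp x0; set q := \poly_(i < _) _.
have sz (f : {poly int}) : (size f <= t.+1)%N ->
    (size (map_poly intr f : {poly F}) <= t.+1)%N.
  by apply: leq_trans; exact: size_poly.
rewrite (horner_coef_wide _ (sz _ (size_poly _ _))).
rewrite (horner_coef_wide _ (sz _ sp)) mulr_sumr.
rewrite [RHS](reindex_inj rev_ord_inj) /=; apply: eq_bigr => i _.
have it : (i <= t)%N by rewrite -ltnS.
rewrite !coef_map /= coef_poly ltn_ord subSS.
rewrite [RHS]mulrCA; congr (_ * _).
by rewrite -{2}(subnK it) exprD mulrAC -exprMn divff // expr1n mul1r.
Qed.

Lemma Phi_palindromic (k i : nat) : (1 < k)%N -> (i <= totient k)%N ->
  ('Phi_k)`_(totient k - i) = ('Phi_k)`_i.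
Proof.
move=> k1 ik; set t := totient k.
pose r : {poly int} := \poly_(i < t.+1) ('Phi_k)`_(t - i).
have k0 : (0 < k)%N by apply: ltnW.
have [w wP] := C_prim_root_exists k0.
have w0 : w != 0.
  apply/eqP => w0; have := prim_expr_order wP; rewrite w0 expr0n.
  by case: k k1 {ik t r k0 wP} => // k _ /eqP; rewrite eq_sym oner_eq0.
have wV : k.-primitive_root w^-1.
  have -> : w^-1 = w ^+ k.-1.
    by apply: (mulfI w0); rewrite divff // -exprS prednK // (prim_expr_order wP).
  by rewrite (prim_root_exp_coprime _ wP) coprime_sym coprimenP.
have sPhi := size_Cyclotomic k.
have PhiC z : root (map_poly intr 'Phi_k : {poly algC}) z = k.-primitive_root z.
  by rewrite (Cintr_Cyclotomic wP) root_cyclotomic.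
have ratC (p : {poly int}) :
    map_poly ratr (map_poly intr p : {poly rat}) = map_poly intr p :> {poly algC}.
  by rewrite -map_poly_comp; apply: eq_map_poly => x /=; rewrite ratr_int.
have rootr : root (map_poly intr r : {poly algC}) w.
  rewrite /root horner_rev ?sPhi //.
  by move: wV; rewrite -PhiC => /rootP ->; rewrite mulr0.
have [p [pE _] pP] := minCpolyP w.
have pPhi : p = map_poly intr 'Phi_k.
  apply: (map_poly_inj (ratr : {rmorphism rat -> algC})).
  by rewrite -pE ratC (Cintr_Cyclotomic wP) (minCpoly_cyclotomic wP).
have := pP (map_poly intr r); rewrite ratC rootr pPhi.
move=> /esym/dvdpP[q qE].
have Phi1 : (map_poly intr 'Phi_k : {poly rat}).[1] != 0.
  apply/eqP => h; have : root (map_poly intr 'Phi_k : {poly algC}) 1.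
    have := horner_map (ratr : {rmorphism rat -> algC}) (map_poly intr 'Phi_k) 1.
    by rewrite /= ratC h rmorph1 rmorph0 => e; apply/eqP.
  rewrite PhiC => h1; have := prim_root_exp_coprime 0 h1.
  by rewrite expr0 h1 /coprime gcd0n; case: (k) k1 => [|[|]].
have r1 : (map_poly intr r : {poly rat}).[1] = (map_poly intr 'Phi_k).[1].
  by rewrite horner_rev ?sPhi ?oner_eq0 // expr1n mul1r invr1.
have szQ (f : {poly int}) : size (map_poly intr f : {poly rat}) = size f.
  by apply: size_map_inj_poly => //; exact: intr_inj.
have q0 : q != 0.
  by apply/eqP => h; move: r1 Phi1; rewrite qE h mul0r horner0 => <-; rewrite eqxx.
have sq : (size q <= 1)%N.
  have : (size (map_poly intr r : {poly rat}) <= t.+1)%N.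
    by rewrite szQ; exact: size_poly.
  rewrite qE size_mul // ?szQ ?sPhi; last first.
    by rewrite -size_poly_eq0 szQ sPhi.
  by rewrite addnS /= -addn1 addnC leq_add2l.
have qC := size1_polyC sq.
have qq : q`_0 = 1.
  by apply: (mulIf Phi1); rewrite mul1r -[RHS]r1 qE qC hornerM hornerC coefC.
have rE : r = 'Phi_k.
  apply: (map_inj_poly (f := intr : int -> rat)) => //; first exact: intr_inj.
  by rewrite qE qC qq mul1r.
by rewrite -[in RHS]rE coef_poly ltnS ik.
Qed.

Lemma totient_even (k : nat) : (2 < k)%N -> ~~ odd (totient k).
Proof.
move=> k2; apply/negP => ot.
have k1 : (1 < k)%N by apply: ltnW.
have := horner_rev (F := algC) (eq_leq (size_Cyclotomic k)) (x := -1).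
rewrite oppr_eq0 oner_eq0 => /(_ isT).
have -> : \poly_(i < (totient k).+1) ('Phi_k)`_(totient k - i) = 'Phi_k.
  apply/polyP => i; rewrite coef_poly ltnS; case: leqP => it.
    exact: Phi_palindromic.
  by rewrite nth_default // size_Cyclotomic.
rewrite invrN invr1 -signr_odd ot expr1 mulN1r => /eqP; rewrite -addr_eq0.
rewrite -mulr2n mulrn_eq0 /= => h.
have [w wP] := C_prim_root_exists (ltnW k1).
have : root (map_poly intr 'Phi_k : {poly algC}) (-1) by [].
rewrite (Cintr_Cyclotomic wP) (root_cyclotomic wP) => m1.
have := prim_order_dvd m1 2; rewrite sqrrN expr1n eqxx => /(dvdn_leq (isT : (0 < 2)%N)).
by rewrite leqNgt k2.
Qed.

Lemma trace_poly_spec (F : fieldType) (f : {poly int}) (d : nat) (z : F) :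
    size f = d.*2.+1 -> (forall i, (i <= d)%N -> f`_(d - i) = f`_(d + i)) ->
    z != 0 ->
  (map_poly intr f).[z] = z ^+ d * (map_poly intr (trace_poly f)).[z + z^-1].
Proof.
move=> sf pal z0.
have sfF : (size (map_poly intr f : {poly F}) <= d.*2.+1)%N.
  by rewrite -sf; exact: size_poly.
rewrite (horner_coef_wide _ sfF) /trace_poly sf /= doubleK.
rewrite rmorphD rmorph_sum /= map_polyC /= hornerD hornerC horner_sum.
rewrite mulrDr mulr_sumr.
under [in RHS]eq_bigr => i _.
  rewrite linearZ /= hornerZ Hpoly_spec // mulrCA mulrDr mulrDr.
  over.
rewrite big_split /=.
rewrite -(big_mkord xpredT (fun i => (map_poly intr f)`_i * z ^+ i)).
rewrite (big_cat_nat (n := d)) //=; last by rewrite leqW // -addnn leq_addr.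
rewrite (big_ltn (m := d)); last by rewrite ltnS -addnn leq_addr.
rewrite addrCA; congr (_ + _); first by rewrite coef_map mulrC.
rewrite addrC; congr (_ + _).
- rewrite [LHS](_ : _ = \sum_(1 + d <= i < d.+1 + d) (map_poly intr f)`_i * z ^+ i);
    last by rewrite add1n addSn addnn.
  rewrite big_addn addnK; apply: eq_bigr => i _.
  by rewrite coef_map /= -exprD addnC.
- rewrite big_nat_rev /= add0n.
  rewrite big_add1 /=; apply: eq_big_nat => i /andP[_ id].
  rewrite coef_map /= pal //; congr (_ * _).
  by rewrite -{2}(subnK id) exprD -mulrA divff ?mulr1 // expf_neq0.
Qed.

Lemma CTpoly_spec (F : fieldType) (k : nat) (z : F) : (2 < k)%N -> z != 0 ->
  (map_poly intr 'Phi_k).[z] =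
    z ^+ (totient k)./2 * (map_poly intr (CTpoly k)).[z + z^-1].
Proof.
move=> k2 z0; have te := totient_even k2.
have tE : (totient k)./2.*2 = totient k by rewrite even_halfK.
have -> : CTpoly k = trace_poly 'Phi_k by case: k k2 {te tE} => [|[|[|k]]].
apply: trace_poly_spec => //; first by rewrite tE size_Cyclotomic.
set d := (totient k)./2 in tE *; move=> i id.
rewrite -[RHS]Phi_palindromic ?(ltnW k2) -?tE -?addnn ?leq_add2l //.
by rewrite subnDl.
Qed.

Lemma rnum_rden_frac (p q : {poly rat}) : q != 0 ->
  exists2 g : {poly rat}, g != 0 &
    p = g * rnum (tofrac p / tofrac q) /\ q = g * rden (tofrac p / tofrac q).
Proof.
move=> q0; rewrite /rnum /rden /=; set f := tofrac p / tofrac q.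
set r := repr f; set n := \n_r; set e := \d_r.
have e0 : e != 0 by exact: denom_ratioP.
have fE : f = tofrac n / tofrac e.
  rewrite -[LHS]reprK -/r -{1}[r]Ratio_numden; unlock FracField.tofrac.
  rewrite -[X in _ = _ * X]FracField.pi_inv -[RHS]FracField.pi_mul.
  by rewrite /FracField.mulf /FracField.invf !numden_Ratio ?oner_eq0 //
    ?mulr1 ?mul1r.
have cross : p * e = n * q.
  apply/eqP; rewrite -tofrac_eq !tofracM; apply/eqP.
  have pf : tofrac p = f * tofrac q by rewrite divfK // tofrac_eq0.
  have nf : tofrac n = f * tofrac e by rewrite fE divfK // tofrac_eq0.
  by rewrite pf nf mulrAC.
have c0 : gcdp n e != 0 by rewrite gcdp_eq0 negb_and e0 orbT.
set n' := n %/ gcdp n e; set e' := e %/ gcdp n e.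
have nE : n = n' * gcdp n e by rewrite divpK // dvdp_gcdl.
have eE : e = e' * gcdp n e by rewrite divpK // dvdp_gcdr.
have e'0 : e' != 0 by apply: contraNneq e0 => h; rewrite eE h mul0r.
have cross' : p * e' = n' * q.
  by apply: (mulIf c0); rewrite -mulrA -eE cross [n in LHS]nE mulrAC.
have cop : coprimep e' n'.
  by rewrite coprimep_sym coprimep_div_gcd // e0 orbT.
have : e' %| q by rewrite -(Gauss_dvdpr _ cop) -cross' dvdp_mull.
case/dvdpP => g qE; exists g.
  by apply: contraNneq q0 => h; rewrite qE h mul0r.
split=> //; apply: (mulIf e'0); rewrite cross' qE.
by rewrite mulrA [n' * g]mulrC.
Qed.

Lemma reval_frac (F : numFieldType) (p q : {poly rat}) (x : F) :
    ~~ root (map_poly ratr q) x ->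
  regular_at (tofrac p / tofrac q) x /\
  reval (tofrac p / tofrac q) x =
    (map_poly ratr p).[x] / (map_poly ratr q).[x].
Proof.
move=> qx; have q0 : q != 0.
  by apply: contraNneq qx => ->; rewrite rmorph0 root0.
have [g g0 []] := rnum_rden_frac p q0.
move: qx; rewrite /regular_at /reval; move: (_ / _) => f qx pE qE.
move: qx; rewrite {}qE {}pE !rmorphM /= !hornerM rootM negb_or.
case/andP=> gx dx; split=> //.
by rewrite -mulf_div divff ?mul1r.
Qed.

Lemma rcomp_frac (p q h : {poly rat}) : q != 0 -> (1 < size h)%N ->
  rcomp (tofrac p / tofrac q) h = tofrac (p \Po h) / tofrac (q \Po h).
Proof.
move=> q0 h1; have [g g0 []] := rnum_rden_frac p q0.
rewrite /rcomp; move: (tofrac p / tofrac q) => f -> ->.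
rewrite !comp_polyM !tofracM -mulf_div divff ?mul1r //.
by rewrite tofrac_eq0 comp_poly_eq0.
Qed.

(* Main.v *)
Require Import Defs.
From HB Require Import structures.
From mathcomp Require Import all_boot all_order all_algebra all_field.
From mathcomp Require Import generic_quotient boolp classical_sets reals.
From mathcomp Require Import complex.
From mathcomp Require polyorder.
From mathcomp Require Import ring lra zify.

(** Put lh = lambda^(1/2), rhohat = lh + 1/lh, p = Phat(rhohat), so that
    Q(rho) = p^2 - 2 ([Qfun_reval]).  The real number p stands to lh as
    alpha + 1/alpha stands to delta^(1/2): since lh and delta^(1/2) have the same
    minimal polynomial, the field isomorphism between Q(lh) and Q(delta^(1/2))
    carries one to the other ([transfer]).  Now alpha^N = delta^(M/2) says, up to
    replacing M by -M, that H_N(alpha + 1/alpha) = H_M(delta^(1/2) + delta^(-1/2)),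
    an equation inside Q(delta^(1/2)); it is therefore equivalent to the equation
    H_N(p) = H_M(rhohat) between real numbers ([mult_dep_real]).  As delta is not a
    root of unity, dependence of the pair means that such an equation holds with
    N > 0.

    If |p| <= 2, then H_N(p) <= 2, while H_M(rhohat) > 2 for M <> 0.  So
    dependence means that Q(rho) = b + 1/b for a root of unity b, i.e. that Q(rho)
    is a root of some CT_k.  The divisibility by phi(k) is automatic: the value
    Q(rho) is in the field generated by rho, so its degree divides that of rho, and
    a number conjugate to its inverse but different from it has twice the degree of
    its trace ([degQ_trace]), which applies to lambda and, for k > 2, to b.  A
    resonance would make delta a root of unity.

    If p^2 - 2 > 2, write it as B + 1/B with B > 1.  Dependence means
    B^N = lambda^M with N, M > 0, and then B = mu^j, lambda = mu^k for coprime
    j, k and a real mu > 1 ([common_base]).  This mu is a Salem number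
    ([salem_root]): a conjugate z of mu satisfies
    z^j + z^-j = Q(z^k + z^-k), with z^k conjugate to lambda, which leaves only mu,
    1/mu and the unit circle.  Finally, the isomorphism above respects all
    multiplicative relations, so alpha may be replaced by the real number
    a = s nu^j and delta^(1/2) by nu^k, where nu = mu^(1/2) and s is the sign of p
    ([non_resonant_large]).  Resonance becomes a linear equation between exponents,
    with a parity condition when s = -1 ([resonance_arith]). *)

Set Implicit Arguments.
Unset Strict Implicit.
Unset Printing Implicit Defensive.

Import Order.TTheory GRing.Theory Num.Theory.
Local Open Scope ring_scope.
Local Open Scope quotient_scope.

(** * Conjugate numbers and the isomorphism between the fields they generate *)

Lemma root_irreducible (K F : fieldType) (phi : {rmorphism K -> F})
    (p g : {poly K}) (x : F) :
  irreducible_poly p -> root (map_poly phi p) x ->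
  root (map_poly phi g) x = (p %| g).
Proof.
move=> pI px; apply/idP/idP => [gx|/dvdpP[h ->]]; last first.
  by rewrite rmorphM rootM px orbT.
apply: contraTT gx; rewrite -irreducible_poly_coprime // -(coprimep_map phi).
by move=> /coprimep_root/(_ px).
Qed.

(** For a root z of [p] in an extension L of degree deg p, [q] is the minimal
    polynomial of g(z); its degree is that of a subfield of L. *)
Lemma irreducible_image (K : fieldType) (p g : {poly K}) :
    irreducible_poly p ->
  exists q : {poly K}, [/\ q \is monic, irreducible_poly q, p %| q \Po g
    & ((size q).-1 %| (size p).-1)%N].
Proof.
move=> pI; have [L dimL [z pz _]] := irredp_FAdjoin pI.
pose y := (map_poly (in_alg L) g).[z].
have [q qE] := polyOver1P (minPolyOver 1%AS y).
have szq : size q = size (minPoly 1%AS y) by rewrite qE size_map_poly.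
have qI : irreducible_poly q.
  split=> [|h h1 hq]; first by rewrite szq size_minPoly ltnS.
  have : map_poly (in_alg L) h %| minPoly 1%AS y by rewrite qE dvdp_map.
  have hO : map_poly (in_alg L) h \is a polyOver 1%AS.
    by apply/polyOver1P; exists h.
  move/(minPoly_irr hO); rewrite qE eqp_map.
  have -> : (map_poly (in_alg L) h %= 1) = (h %= 1).
    by rewrite -(eqp_map (in_alg L)) rmorph1.
  by case/orP => // /eqp_size; rewrite size_poly1 => h1'; rewrite h1' in h1.
exists q; split => //.
- by rewrite -(map_monic (in_alg L)) -qE monic_minPoly.
- rewrite -(root_irreducible _ pI pz) map_comp_poly /root horner_comp -/y.
  by rewrite -qE minPolyxx.
- rewrite -dimL szq size_minPoly /=.
  have := dim_Fadjoin 1%AS y; rewrite dimv1 muln1 => <-.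
  exact/field_dimS/subvf.
Qed.

(** The two numbers may live in different fields, as [lh] and [sd] do below.
    On the diagonal, [coconj x x] says that [x] is algebraic. *)
Definition coconj (F F' : numFieldType) (x : F) (y : F') : Prop :=
  exists2 p : {poly rat}, is_minpoly x p & is_minpoly y p.

(** When [x] and [y] have the same minimal polynomial, this is the graph of the
    isomorphism from Q(x) to Q(y) sending [x] to [y].  Identities between
    rational expressions are moved along it without any Galois group. *)
Definition transfer (F F' : numFieldType) (x : F) (y : F') (u : F) (v : F')
    : Prop :=
  exists g : {poly rat}, u = (map_poly ratr g).[x] /\ v = (map_poly ratr g).[y].

Lemma transfer_sym (F F' : numFieldType) (x : F) (y : F') u v :
  transfer x y u v -> transfer y x v u.
Proof. by case=> g [-> ->]; exists g. Qed.

Lemma coconj_sym (F F' : numFieldType) (x : F) (y : F') :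
  coconj x y -> coconj y x.
Proof. by case=> p px py; exists p. Qed.

Lemma minpoly_root (F : numFieldType) (x : F) p (g : {poly rat}) :
  is_minpoly x p -> root (map_poly ratr g) x = (p %| g).
Proof. by case=> _ pI px; apply: root_irreducible. Qed.

Lemma minpoly_uniq (F : numFieldType) (x : F) p q :
  is_minpoly x p -> is_minpoly x q -> p = q.
Proof.
move=> mp mq; have [pm _ px] := mp; have [qm _ qx] := mq.
apply/eqP; rewrite -eqp_monic // /eqp -(minpoly_root _ mp) qx.
by rewrite -(minpoly_root _ mq).
Qed.

Lemma degQ_minpoly (F : numFieldType) (x : F) p :
  is_minpoly x p -> degQ x = (size p).-1.
Proof.
move=> mp; have mx : is_minpoly x (minpoly x).
  by apply: (@xgetPex _ 0 (is_minpoly x)); exists p.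
by rewrite /degQ (minpoly_uniq mp mx).
Qed.

Lemma conjugate_coconj (F : numFieldType) (x y : F) :
  conjugate x y -> coconj x y.
Proof. by case=> p px py; exists p => //; case: px => pm pI _; split. Qed.

Lemma coconj_conjugate (F : numFieldType) (x y : F) :
  coconj x y -> conjugate x y.
Proof. by case=> p px [_ _ py]; exists p. Qed.

Lemma minpoly_real (R : rcfType) (x : R) p :
  is_minpoly (x%:C)%C p <-> is_minpoly x p.
Proof.
suff E : root (map_poly ratr p) (x%:C)%C = root (map_poly ratr p) x.
  by split=> -[? ? h]; split=> //; rewrite ?E // -E.
rewrite -(fmorph_root (real_complex R)) -map_poly_comp.
by congr (root _ _); apply: eq_map_poly => c /=; rewrite fmorph_rat.
Qed.

Section Transfer.
Variables (F F' : numFieldType) (x : F) (y : F').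
Local Notation T := (transfer x y).

Lemma transfer_id : T x y.
Proof. by exists 'X; rewrite !map_polyX !hornerX. Qed.

Lemma transfer_rat (c : rat) : T (ratr c) (ratr c).
Proof. by exists c%:P; rewrite !map_polyC !hornerC. Qed.

Lemma transfer_int (c : int) : T c%:~R c%:~R.
Proof. by have := transfer_rat c%:~R; rewrite !ratr_int. Qed.

Lemma transferD u v u' v' : T u v -> T u' v' -> T (u + u') (v + v').
Proof.
by move=> [g [-> ->]] [h [-> ->]]; exists (g + h); rewrite !rmorphD !hornerD.
Qed.

Lemma transferM u v u' v' : T u v -> T u' v' -> T (u * u') (v * v').
Proof.
by move=> [g [-> ->]] [h [-> ->]]; exists (g * h); rewrite !rmorphM !hornerM.
Qed.

Lemma transferX u v n : T u v -> T (u ^+ n) (v ^+ n).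
Proof. by move=> [g [-> ->]]; exists (g ^+ n); rewrite !rmorphXn !horner_exp. Qed.

Lemma transfer_horner h u v : T u v ->
  T (map_poly ratr h).[u] (map_poly ratr h).[v].
Proof.
by move=> [g [-> ->]]; exists (h \Po g); rewrite !map_comp_poly !horner_comp.
Qed.

Lemma ratr_intr_poly (K : numFieldType) (h : {poly int}) :
  map_poly ratr (map_poly intr h : {poly rat}) = map_poly intr h :> {poly K}.
Proof. by rewrite -map_poly_comp; apply: eq_map_poly => c /=; rewrite ratr_int. Qed.

Lemma transfer_hornerz (h : {poly int}) u v : T u v ->
  T (map_poly intr h).[u] (map_poly intr h).[v].
Proof. by move/(transfer_horner (map_poly intr h)); rewrite !ratr_intr_poly. Qed.

Hypothesis xy : coconj x y.

Lemma transfer0 u v : T u v -> (u == 0) = (v == 0).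
Proof.
have [p px py] := xy; move=> [g [-> ->]].
by rewrite -/(root _ _) (minpoly_root _ px) -/(root _ _) (minpoly_root _ py).
Qed.

Lemma transfer_eq u v u' v' : T u v -> T u' v' -> (u = u') <-> (v = v').
Proof.
move=> uv u'v'; have := transferD uv (transferM (transfer_int (-1)) u'v').
rewrite !mulrN1z !mulN1r => /transfer0; rewrite !subr_eq0 => e.
by split=> /eqP; [rewrite e | rewrite -e] => /eqP.
Qed.

(* Inversion modulo the minimal polynomial is Bezout's identity. *)
Lemma transferV u v : T u v -> T u^-1 v^-1.
Proof.
move=> uv; have [u0|u0] := eqVneq u 0.
  have /eqP v0 : v == 0 by rewrite -(transfer0 uv) u0.
  by rewrite u0 v0 !invr0; exact: (transfer_int 0).
have [p px py] := xy; case: uv u0 => g [-> ->] {u v}.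
rewrite -/(root _ _) (minpoly_root _ px) -irreducible_poly_coprime; last by case: px.
case/Bezout_eq1_coprimepP => -[a b] /= e; exists b.
have inv (K : numFieldType) (t : K) : is_minpoly t p ->
    (map_poly ratr g).[t]^-1 = (map_poly ratr b).[t].
  move=> [_ _ /rootP pt]; have := congr1 (fun h => (map_poly ratr h).[t]) e.
  rewrite /= rmorphD !rmorphM rmorph1 /= !hornerE pt mulr0 add0r => bg.
  have g0 : (map_poly ratr g).[t] != 0.
    by apply: contraPneq bg => ->; rewrite mulr0 => /esym/eqP; rewrite oner_eq0.
  by apply: (mulIf g0); rewrite mulVf.
by rewrite !inv.
Qed.

Lemma transfer_reval f u v : T u v -> regular_at f u ->
  regular_at f v /\ T (reval f u) (reval f v).
Proof.
move=> uv fu; split.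
  by move: fu; rewrite /regular_at /root (transfer0 (transfer_horner _ uv)).
by apply: transferM; [|apply: transferV]; apply: transfer_horner.
Qed.

Lemma transfer_coconj u v : T u v -> coconj u v.
Proof.
have [p px py] := xy; move=> [g [-> ->]].
have [_ pI _] := px; have [q [qm qI qg _]] := irreducible_image g pI.
exists q; split=> //; rewrite /root -horner_comp -map_comp_poly -/(root _ _).
  by rewrite (minpoly_root _ px).
by rewrite (minpoly_root _ py).
Qed.

End Transfer.

Lemma degQ_dvd (F : numFieldType) (x : F) (g : {poly rat}) :
  coconj x x -> (degQ (map_poly ratr g).[x] %| degQ x)%N.
Proof.
case=> p px _; have [_ pI _] := px.
have [q [qm qI qg d]] := irreducible_image g pI.
rewrite (degQ_minpoly px) (@degQ_minpoly _ _ q) //; split=> //.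
by rewrite /root -horner_comp -map_comp_poly -/(root _ _) (minpoly_root _ px).
Qed.

(** [x] has degree at most 2 over Q(x + 1/x).  It has degree exactly 2, since
    otherwise [x] would be a rational expression in x + 1/x, and the
    isomorphism sending [x] to its conjugate 1/x would fix it. *)
Lemma degQ_trace (F : numFieldType) (x : F) :
  x != 0 -> x != x^-1 -> coconj x x^-1 -> degQ x = (2 * degQ (x + x^-1))%N.
Proof.
move=> x0 xV xx; have [p px pVx] := xx; have [_ pI _] := px.
have tV : transfer x x^-1 x^-1 x.
  by have := transferV xx (transfer_id x x^-1); rewrite invrK.
have tS : transfer x x^-1 (x + x^-1) (x + x^-1).
  rewrite [in X in transfer _ _ _ X]addrC; apply: transferD => //.
  exact: transfer_id.
have [q sq _] := transfer_coconj xx tS; have [_ qI _] := sq.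
rewrite (degQ_minpoly px) (degQ_minpoly sq).
have [t [t1 t2]] := tV.
have [L dimL [z pz zL]] := irredp_FAdjoin pI.
(* The values of h at z and of h at x vanish together, so that identities
   between polynomials in z can be read in x. *)
pose ev (h : {poly rat}) := (map_poly (in_alg L) h).[z].
have evE h k : (ev h == ev k) = ((map_poly ratr h).[x] == (map_poly ratr k).[x]).
  rewrite /ev -subr_eq0 -hornerN -hornerD -rmorphB -/(root _ _).
  rewrite (root_irreducible _ pI pz) -(minpoly_root _ px).
  by rewrite /root rmorphB hornerD hornerN subr_eq0.
have evX : ev 'X = z by rewrite /ev map_polyX hornerX.
have zt : z * ev t = 1.
  have : ev ('X * t) == ev 1.
    by rewrite evE rmorphM rmorph1 /= !hornerE -t1 map_polyX hornerX divff.
  by rewrite /ev rmorphM rmorph1 /= !hornerE map_polyX hornerX => /eqP.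
pose s := z + ev t.
have sE : s = ev ('X + t) by rewrite /s /ev rmorphD /= !hornerE map_polyX hornerX.
have qs : root (map_poly (in_alg L) q) s.
  rewrite sE /ev /root -horner_comp -map_comp_poly -/(root _ _).
  rewrite (root_irreducible _ pI pz) -(minpoly_root _ px).
  rewrite /root map_comp_poly horner_comp rmorphD /= hornerD -t1.
  by rewrite map_polyX hornerX; case: sq.
have ds : adjoin_degree 1%AS s = (size q).-1.
  have [h hE] := polyOver1P (minPolyOver 1%AS s).
  have : map_poly (in_alg L) h %| map_poly (in_alg L) q.
    by rewrite -hE minPoly_dvdp //; apply/polyOver1P; exists q.
  rewrite dvdp_map => hq.
  have hsz : size h = (adjoin_degree 1%AS s).+1.
    by rewrite -size_minPoly hE size_map_poly.
  have [_ /(_ h)] := qI; rewrite hsz eqSS => /(_ isT hq) /eqp_size.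
  by rewrite hsz => <-.
have d1 := dim_Fadjoin 1%AS s; rewrite dimv1 muln1 ds in d1.
have d2 := dim_Fadjoin <<1; s>>%AS z.
have full : <<<<1; s>>; z>>%VS = fullv.
  apply/eqP; rewrite eqEsubv subvf -{1}zL.
  by apply/FadjoinP; split; [exact: sub1v | exact: memv_adjoin].
rewrite full dimL d1 in d2; rewrite d2.
(* z is a root of X^2 - s X + 1. *)
have le2 : (adjoin_degree <<1; s>>%AS z <= 2)%N.
  pose w : {poly L} := 'X^2 - s *: 'X + 1.
  have szw : size w = 3%N.
    rewrite /w -addrA size_polyDl ?size_polyXn //.
    rewrite (leq_ltn_trans (size_polyD _ _)) // gtn_max size_polyC oner_eq0.
    by rewrite size_polyN (leq_ltn_trans (size_scale_leq _ _)) ?size_polyX.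
  have wO : w \is a polyOver <<1; s>>%AS.
    rewrite rpredD ?rpredB ?rpred1 ?polyOverXn ?polyOverZ ?polyOverX //.
    exact: memv_adjoin.
  have wz : root w z.
    rewrite /root /w !hornerE /s mulrDl [ev t * z]mulrC zt.
    by apply/eqP; ring.
  have := dvdp_leq _ (minPoly_dvdp wO wz).
  by rewrite -size_poly_eq0 szw size_minPoly ltnS => ->.
have ge1 : adjoin_degree <<1; s>>%AS z != 1%N.
  rewrite adjoin_deg_eq1; apply/negP => /Fadjoin_polyP[_ /polyOver1P[g ->] zE].
  have : ev 'X == ev (g \Po ('X + t)).
    by rewrite evX {1}zE sE /ev map_comp_poly horner_comp.
  rewrite evE map_comp_poly horner_comp rmorphD /= map_polyX hornerD !hornerX -t1.
  move/eqP => xE.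
  have := transfer_horner g tS; rewrite -xE => tx.
  have [/(_ erefl) e _] := transfer_eq xx (transfer_id x x^-1) tx.
  by rewrite e eqxx in xV.
have ge0 : (0 < adjoin_degree <<1; s>>%AS z)%N by [].
by case: (adjoin_degree _ _) ge0 ge1 le2 => [|[|[|]]].
Qed.

(** * Multiplicative relations *)

Lemma addV_eq (F : fieldType) (u v : F) : u != 0 -> v != 0 ->
  u + u^-1 = v + v^-1 <-> u = v \/ u = v^-1.
Proof.
move=> u0 v0; split=> [e|[->//|->]]; last by rewrite invrK addrC.
have /eqP : (u - v) * (u - v^-1) = 0.
  have -> : (u - v) * (u - v^-1) = u * (u - (v + v^-1)) + v * v^-1 by ring.
  by rewrite -e divff // opprD addNKr mulrN divff // addNr.
by rewrite mulf_eq0 !subr_eq0 => /orP[] /eqP; [left | right].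
Qed.

Lemma Hpoly_int (F : fieldType) (z : F) (n : int) : z != 0 ->
  (map_poly intr (Hpoly `|n|)).[z + z^-1] = z ^ n + z ^ (- n).
Proof.
move=> z0; rewrite Hpoly_spec // -invr_expz; case: n => n //.
by rewrite /= invrK addrC.
Qed.

Definition not_root1 (F : fieldType) (t : F) : Prop :=
  forall n : int, t ^ n = 1 -> n = 0.

Lemma not_root1_inj (F : fieldType) (t : F) (x y : int) : t != 0 ->
  not_root1 t -> t ^ x = t ^ y -> x = y.
Proof.
move=> t0 tn e; apply/eqP; rewrite -subr_eq0; apply/eqP/tn.
by rewrite expfzDr // e -expfzDr // subrr.
Qed.

Lemma expfz_pair (F : fieldType) (t a : F) (m : nat) (n1 n2 : int) :
    t != 0 -> a != 0 ->
  (t ^+ m * a) ^ n1 * (t ^+ m * a^-1) ^ n2 = a ^ (n1 - n2) * t ^ (m%:Z * (n1 + n2)).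
Proof.
move=> t0 a0; rewrite !expfzMl !exprnP !exprz_exp mulrDr !expfzDr //.
by rewrite exprz_inv; ring.
Qed.

(** A relation (t^m a)^n1 = (t^m / a)^n2 reads a^(n1 + n2) = t^(m (n2 - n1)).
    If n1 + n2 = 0 then t is a root of unity unless n1 = n2 = 0, so a nontrivial
    relation always involves a nonzero power of [a]. *)
Lemma mult_depP (F : fieldType) (t a : F) (m : nat) :
    t != 0 -> a != 0 -> (0 < m)%N -> not_root1 t ->
  mult_dep (t ^+ m * a) (t ^+ m * a^-1) <->
    exists (N : nat) (y : int), (0 < N)%N /\ a ^ N%:Z = t ^ y.
Proof.
move=> t0 a0 m0 tn.
have E n1 n2 : ((t ^+ m * a) ^ n1 = (t ^+ m * a^-1) ^ n2) <->
    (a ^ (n1 + n2) = t ^ (m%:Z * (n2 - n1))).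
  have t2 : t ^+ m * a^-1 != 0 by rewrite mulf_neq0 ?invr_eq0 ?expf_neq0.
  have := expfz_pair m n1 (- n2) t0 a0; rewrite opprK => e.
  split=> [h|h].
    move: e; rewrite h -expfzDr // subrr expr0z => e.
    have -> : m%:Z * (n2 - n1) = - (m%:Z * (n1 - n2)) by ring.
    by rewrite -invr_expz -[LHS](mulfK (expfz_neq0 (m%:Z * (n1 - n2)) t0)) -e mul1r.
  move: e; rewrite h -expfzDr // => e.
  apply: (mulIf (expfz_neq0 (- n2) t2)).
  rewrite e -expfzDr // subrr.
  by have -> : m%:Z * (n2 - n1) + m%:Z * (n1 - n2) = 0 by ring.
split=> [md|[N [y [N0 e]]] mi].
  apply: contrapT => none; apply: md => n1 n2 /E e.
  have s0 : n1 + n2 = 0.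
    apply/eqP/negPn/negP => s0; apply: none.
    exists (absz (n1 + n2)); rewrite absz_gt0 s0 abszE.
    case: (ger0P (n1 + n2)) => _; first by eexists; split; [|exact: e].
    exists (- (m%:Z * (n2 - n1))); split=> //.
    by rewrite -!invr_expz e.
  move: e; rewrite s0 expr0z => /esym/tn => e.
  by nia.
(* n1 + n2 = 2 m N and m (n2 - n1) = 2 m y: the factor 2 m makes the required
   exponents n1 and n2 integers. *)
have [] := mi (m%:Z * N%:Z - y) (m%:Z * N%:Z + y).
  apply/E; have -> : m%:Z * N%:Z - y + (m%:Z * N%:Z + y) = N%:Z * (2 * m%:Z) by ring.
  by rewrite -exprz_exp e exprz_exp; congr (t ^ _); ring.
nia.
Qed.

Lemma non_resonantP (F : fieldType) (t a : F) (m : nat) :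
    t != 0 -> a != 0 ->
  non_resonant (t ^+ m * a) (t ^+ m * a^-1) <->
  forall n1 n2 : nat, (2 <= n1 + n2)%N ->
    a ^ (1 - n1%:Z + n2%:Z) <> t ^ (m%:Z * (n1%:Z + n2%:Z - 1)) /\
    a ^ (- 1 - n1%:Z + n2%:Z) <> t ^ (m%:Z * (n1%:Z + n2%:Z - 1)).
Proof.
move=> t0 a0.
have E (e : int) n1 n2 : t ^+ m * a ^ e = (t ^+ m * a) ^+ n1 * (t ^+ m * a^-1) ^+ n2 <->
    a ^ (e - n1%:Z + n2%:Z) = t ^ (m%:Z * (n1%:Z + n2%:Z - 1)).
  have := expfz_pair m n1 n2 t0 a0.
  rewrite -(exprnP (t ^+ m * a)) -(exprnP (t ^+ m / a)) => ->.
  have -> : a ^ (e - n1%:Z + n2%:Z) = a ^ e * a ^ (- (n1%:Z - n2%:Z)).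
    by rewrite -expfzDr //; congr (a ^ _); ring.
  have -> : t ^ (m%:Z * (n1%:Z + n2%:Z - 1)) = t ^ (m%:Z * (n1%:Z + n2%:Z)) / t ^+ m.
    by rewrite exprnP invr_expz -expfzDr //; congr (t ^ _); ring.
  rewrite -invr_expz.
  have A0 := expfz_neq0 (n1%:Z - n2%:Z) a0; have T0 := expf_neq0 m t0.
  move: (a ^ (_ - _)) A0 (t ^+ m) T0 (a ^ e) (t ^ _) => A A0 T T0 x y.
  split=> [h|h].
    have -> : y = T * x / A by rewrite h mulrAC divff // mul1r.
    by field; rewrite A0 T0.
  have -> : x = y / T * A by rewrite -h divfK.
  by field; rewrite T0.
split=> H n1 n2 n12; have [h1 h2] := H n1 n2 n12; split=> e.
- by apply: h1; move/(E 1): e.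
- by apply: h2; move/(E (-1)): e.
- by apply: h1; apply/(E 1).
- by apply: h2; apply/(E (-1)).
Qed.

(** Both resonance equations are relations between powers of [a] and [t]. *)
Lemma non_resonant_transfer (F F' : fieldType) (t a : F) (t' a' : F') (m : nat) :
    t != 0 -> a != 0 -> t' != 0 -> a' != 0 ->
    (forall x y : int, a ^ x = t ^ y <-> a' ^ x = t' ^ y) ->
  non_resonant (t ^+ m * a) (t ^+ m * a^-1) <->
  non_resonant (t' ^+ m * a') (t' ^+ m * a'^-1).
Proof.
move=> t0 a0 t0' a0' E; split=> /non_resonantP H; apply/non_resonantP => //.
  move=> n1 n2 n12; have [//|//|h1 h2] := H _ _ n1 n2 n12.
  by split=> /E.
move=> n1 n2 n12; have [//|//|h1 h2] := H _ _ n1 n2 n12.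
by split=> /E.
Qed.

Lemma non_resonant_sym (F : fieldType) (a b : F) :
  non_resonant a b -> non_resonant b a.
Proof.
move=> H n1 n2 n12; have [|h1 h2] := H n2 n1; first by rewrite addnC.
by split; rewrite mulrC.
Qed.

(** The sums u + 1/u only see powers up to inversion.  One common relation
    a^N = t^M fixes the orientation of all the others. *)
Lemma relation_transfer (F F' : fieldType) (t a : F) (t' a' : F') (N M : int) :
    t != 0 -> a != 0 -> t' != 0 -> a' != 0 -> not_root1 t -> not_root1 t' ->
    a ^ N = t ^ M -> a' ^ N = t' ^ M -> N != 0 ->
    (forall x y : int, a ^ x + a ^ (- x) = t ^ y + t ^ (- y) ->
       a' ^ x + a' ^ (- x) = t' ^ y + t' ^ (- y)) ->
  forall x y : int, a ^ x = t ^ y -> a' ^ x = t' ^ y.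
Proof.
move=> t0 a0 t0' a0' tn tn' e e' N0 H x y xy.
have := H x y; rewrite -!invr_expz xy => /(_ erefl).
case/addV_eq; rewrite ?expfz_neq0 // => h.
have h1 : M * x = y * N.
  apply: (not_root1_inj t0 tn).
  by rewrite -!exprz_exp -e exprzAC xy.
have h2 : M * x = - y * N.
  apply: (not_root1_inj t0' tn').
  by rewrite -!exprz_exp -e' exprzAC h invr_expz.
have y0 : y = 0 by nia.
by rewrite h y0 expr0z invr1.
Qed.

(** * The rational function Q *)

Lemma ratfun_fracE (f : ratfun) :
  [/\ rden f != 0, f = tofrac (rnum f) / tofrac (rden f)
    & coprimep (rden f) (rnum f)].
Proof.
pose n := \n_(repr f); pose d := \d_(repr f).
have d0 : d != 0 by exact: denom_ratioP.
have dd : rden f * gcdp n d = d by rewrite divpK // dvdp_gcdr.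
have nn : rnum f * gcdp n d = n by rewrite divpK // dvdp_gcdl.
have g0 : gcdp n d != 0 by rewrite gcdp_eq0 negb_and d0 orbT.
have rd0 : rden f != 0 by apply: contraNneq d0 => h; rewrite -dd h mul0r.
split=> //; last by rewrite coprimep_sym coprimep_div_gcd // d0 orbT.
have -> : tofrac (rnum f) / tofrac (rden f) = tofrac n / tofrac d.
  set g := gcdp n d in dd nn g0; rewrite -nn -dd !tofracM -mulf_div divff ?mulr1 //.
  by rewrite tofrac_eq0.
rewrite -[LHS]reprK -[in LHS](Ratio_numden (repr f)) -/n -/d.
unlock FracField.tofrac.
rewrite -[X in _ = _ * X]FracField.pi_inv -[RHS]FracField.pi_mul.
by rewrite /FracField.mulf /FracField.invf !numden_Ratio ?oner_eq0 //
    ?mulr1 ?mul1r.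
Qed.

Lemma H2Q_horner (F : numFieldType) (w : F) : (map_poly ratr H2Q).[w] = w ^+ 2 - 2.
Proof.
rewrite /H2Q ratr_intr_poly /= rmorphB rmorphM /= map_polyX map_polyC /= !hornerE.
by rewrite expr2.
Qed.

(** The pole condition at [w] only has to be checked on Phat: the numerator
    and denominator of P have no common zero, so a pole of P at w^2 - 2 cannot
    be compensated in Phat. *)
Lemma Qfun_reval (F : numFieldType) (m : nat) (Phat P : ratfun) (w : F) :
    w != 0 -> is_associated m Phat P -> regular_at Phat w ->
  regular_at (Qfun m P) (w ^+ 2 - 2) /\
  reval (Qfun m P) (w ^+ 2 - 2) = reval Phat w ^+ 2 - 2.
Proof.
move=> w0 as_ reg; have [d0 PE cop] := ratfun_fracE P.
set n := rnum P in PE cop *; set d := rden P in PE cop d0 *.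
pose x := w ^+ 2 - 2.
have compE (h : {poly rat}) :
    (map_poly ratr (h \Po H2Q)).[w] = (map_poly ratr h).[x].
  by rewrite map_comp_poly horner_comp H2Q_horner.
have szH : (1 < size H2Q)%N.
  rewrite /H2Q size_map_inj_poly //; last exact: intr_inj.
  rewrite /= -expr2 size_polyDl ?size_polyXn // size_polyN size_polyC.
  by case: (_ != _).
pose c : {poly rat} := if odd m then 'X else 1.
have cw : (map_poly ratr c).[w] != 0.
  by rewrite /c; case: odd; rewrite ?map_polyX ?hornerX // rmorph1 hornerC oner_eq0.
have c0 : c != 0.
  by rewrite /c; case: odd; rewrite ?polyX_eq0 ?oner_eq0.
have PhatE : Phat = tofrac (n \Po H2Q) / tofrac (c * (d \Po H2Q)).
  rewrite as_ /rcomp -/n -/d /c; case: odd; last by rewrite mul1r.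
  by rewrite tofracM invfM mulrCA.
have D0 : c * (d \Po H2Q) != 0 by rewrite mulf_neq0 ?comp_poly_eq0.
have dx : (map_poly ratr d).[x] != 0.
  have [g g0 [nE dE]] := rnum_rden_frac (n \Po H2Q) D0.
  rewrite -PhatE in nE dE; apply/negP => dx.
  have gw : (map_poly ratr g).[w] = 0.
    apply/eqP; move: reg; rewrite /regular_at /root => reg.
    rewrite -(mulIr_eq0 _ (mulIf reg)) -hornerM -rmorphM -dE.
    by rewrite rmorphM hornerM compE (eqP dx) mulr0.
  move: cop; rewrite -(coprimep_map (ratr : {rmorphism rat -> F})) => /coprimep_root/(_ dx).
  by rewrite -compE nE rmorphM hornerM gw mul0r eqxx.
have PhatV : reval Phat w = (map_poly ratr n).[x] / ((map_poly ratr c).[w] * (map_poly ratr d).[x]).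
  rewrite PhatE; have [|_ ->] := @reval_frac F (n \Po H2Q) (c * (d \Po H2Q)) w.
    by rewrite /root rmorphM hornerM compE mulf_neq0.
  by rewrite rmorphM hornerM !compE.
pose b : {poly rat} := if odd m then 'X + 2%:P else 1.
have bx : (map_poly ratr b).[x] = (map_poly ratr c).[w] ^+ 2.
  rewrite /b /c; case: odd; last by rewrite rmorph1 !hornerC expr1n.
  by rewrite rmorphD /= map_polyX map_polyC /= ratr_nat hornerD !hornerX hornerC subrK.
have bd0 : b * d ^+ 2 != 0.
  rewrite mulf_neq0 ?expf_neq0 // /b; case: odd; rewrite ?oner_eq0 //.
  by rewrite -size_poly_eq0 size_XaddC.
have QE : Qfun m P = tofrac (n ^+ 2 - 2 * (b * d ^+ 2)) / tofrac (b * d ^+ 2).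
  have B0 : tofrac (b * d ^+ 2) != 0 by rewrite tofrac_eq0.
  rewrite tofracB (tofracM 2) mulrBl mulfK // (rmorph_nat (@tofrac _)).
  rewrite /Qfun PE /b; case: odd; rewrite ?mul1r.
    by rewrite expr_div_n tofracXn tofracM tofracXn [in RHS]invfM mulrCA.
  by rewrite expr_div_n !tofracXn.
have denx : (map_poly ratr (b * d ^+ 2)).[x] =
    (map_poly ratr c).[w] ^+ 2 * (map_poly ratr d).[x] ^+ 2.
  by rewrite rmorphM hornerM rmorphXn horner_exp bx.
rewrite QE; have [|reg' ->] := @reval_frac F (n ^+ 2 - 2 * (b * d ^+ 2)) (b * d ^+ 2) x.
  by rewrite /root denx mulf_neq0 ?expf_neq0.
split=> //; rewrite PhatV rmorphB mulr_natl rmorphMn hornerD hornerN hornerMn.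
rewrite denx rmorphXn horner_exp.
move: (map_poly ratr n).[x] (map_poly ratr d).[x] dx (map_poly ratr c).[w] cw.
by move=> N D D0' C C0; field; rewrite D0' C0.
Qed.

(** * Roots of unity and cyclotomic trace polynomials *)

(** The cyclotomic polynomial is the minimal polynomial over Q of an algebraic
    complex number, a primitive [k]-th root of unity. *)
Lemma Phi_irreducible (k : nat) : (0 < k)%N ->
  irreducible_poly (map_poly intr 'Phi_k : {poly rat}).
Proof.
move=> k0; have [w wP] := C_prim_root_exists k0.
have [p [pE pm] pP] := minCpolyP w.
have -> : map_poly intr 'Phi_k = p.
  apply: (map_poly_inj (ratr : {rmorphism rat -> algC})).
  by rewrite -pE ratr_intr_poly (Cintr_Cyclotomic wP) (minCpoly_cyclotomic wP).
have p0 : p != 0 by apply: monic_neq0.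
split=> [|q q1 qp].
  rewrite ltnNge; apply/negP => /size1_polyC pC.
  have : root (minCpoly w) w by exact: root_minCpoly.
  rewrite pE pC map_polyC /= rootC fmorph_eq0.
  by apply/negP; apply: contraNneq p0 => h; rewrite pC h.
have q0 : q != 0 by apply: contraTneq qp => ->; rewrite dvd0p.
move/dvdpP: (qp) => [h hE].
have : root (map_poly ratr p) w by rewrite -pE root_minCpoly.
rewrite {1}hE rmorphM rootM !pP => /orP[ph|pq]; last by rewrite /eqp pq qp.
have h0 : h != 0 by apply: contraNneq p0 => e; rewrite hE e mul0r.
have q2 : (1 < size q)%N by rewrite ltn_neqAle eq_sym q1 size_poly_gt0.
have := dvdp_leq h0 ph; rewrite {1}hE size_mul //.
by case: (size q) q2 => [|[|n]] // _; rewrite !addnS /= ltnNge leq_addr.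
Qed.

Lemma Phi_monic (k : nat) : (0 < k)%N ->
  (map_poly intr 'Phi_k : {poly rat}) \is monic.
Proof. by move=> k0; apply/monic_map/Cyclotomic_monic. Qed.

Lemma prod_Phi_horner (F : fieldType) (N : nat) (b : F) : (0 < N)%N ->
  \prod_(d <- divisors N) (map_poly intr 'Phi_d).[b] = b ^+ N - 1.
Proof.
move=> N0; rewrite -horner_prod -rmorph_prod /= prod_Cyclotomic //.
by rewrite rmorphB rmorph1 /= map_polyXn !hornerE.
Qed.

Lemma Phi_root1 (F : fieldType) (k : nat) (b : F) : (0 < k)%N ->
  (map_poly intr 'Phi_k).[b] = 0 -> b ^+ k = 1.
Proof.
move=> k0 bk; apply/eqP; rewrite -subr_eq0 -prod_Phi_horner //.
have kk : k \in divisors k by rewrite -dvdn_divisors.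
by rewrite (big_rem _ kk) /= bk mul0r.
Qed.

Lemma prim_root_Phi (F : fieldType) (k : nat) (b : F) :
  k.-primitive_root b -> (map_poly intr 'Phi_k).[b] = 0.
Proof.
move=> bk; have k0 := prim_order_gt0 bk.
have := prod_Phi_horner b k0; rewrite (prim_expr_order bk) subrr => /eqP.
rewrite prodf_seq_eq0 => /hasP[d]; rewrite -dvdn_divisors // => dk /= /eqP bd.
have d0 : (0 < d)%N by apply: dvdn_gt0 dk.
suff -> : k = d by [].
apply/eqP; rewrite eqn_dvd dk andbT (prim_order_dvd bk).
by rewrite (Phi_root1 d0 bd).
Qed.

Lemma CTpoly_root1 (F : fieldType) (k : nat) (b : F) : (0 < k)%N -> b != 0 ->
    (map_poly intr (CTpoly k)).[b + b^-1] = 0 ->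
  exists2 N, (0 < N)%N & b ^+ N = 1.
Proof.
move=> k0 b0; have [k2|] := ltnP 2 k.
  by move=> ct; exists k => //; apply: Phi_root1; rewrite // CTpoly_spec // ct mulr0.
case: k k0 => [//|[_ _|[_ _|//]]].
  rewrite /= rmorphB /= map_polyX map_polyC /= hornerD hornerN hornerX hornerC.
  move=> /eqP; rewrite subr_eq0 => /eqP e; exists 1%N => //.
  have [|] : b = 1 \/ b = 1^-1; last by rewrite invr1.
    by apply/addV_eq; rewrite ?oner_eq0 // e invr1.
  by [].
rewrite /= rmorphD /= map_polyX map_polyC /= hornerD hornerX hornerC.
move=> /eqP; rewrite addr_eq0 => /eqP e; exists 2%N => //.
have [->|->] : b = -1 \/ b = (-1)^-1.
    by apply/addV_eq; rewrite ?oppr_eq0 ?oner_eq0 // e invrN1 -opprD.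
  by rewrite sqrrN expr1n.
by rewrite invrN1 sqrrN expr1n.
Qed.

(** With [k] the exact order of [b], the k-th cyclotomic polynomial is the
    minimal polynomial of both [b] and 1/b.  For k > 2 these are distinct, because
    1 and -1 are rational whereas phi(k) is even, and [degQ_trace] computes the
    degree of the trace. *)
Lemma root1_CTpoly (F : numFieldType) (N : nat) (b : F) : (0 < N)%N -> b ^+ N = 1 ->
  exists k, [/\ (0 < k)%N, (map_poly intr (CTpoly k)).[b + b^-1] = 0
    & (2 < k)%N -> totient k = (2 * degQ (b + b^-1))%N].
Proof.
move=> N0 bN; have [k prk kN] := prim_order_exists N0 bN.
have k0 := prim_order_gt0 prk; have bk := prim_root_Phi prk.
have b0 : b != 0.
  apply: contraPneq bN => ->; rewrite expr0n -[N]prednK //= => /esym/eqP.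
  by rewrite oner_eq0.
have mb (z : F) : (map_poly intr 'Phi_k).[z] = 0 -> is_minpoly z (map_poly intr 'Phi_k).
  move=> zk; split; first exact: Phi_monic.
    exact: Phi_irreducible.
  by rewrite ratr_intr_poly; apply/rootP.
exists k; split => //.
  have [k2|] := ltnP 2 k.
    move: bk; rewrite CTpoly_spec // => /eqP.
    by rewrite mulf_eq0 expf_eq0 (negPf b0) andbF => /eqP.
  have two := prim_expr_order prk.
  case: k k0 prk two {bk mb kN} => [//|[|[|//]]] _ prk two _.
    move: two; rewrite expr1 => ->.
    rewrite /= rmorphB /= map_polyX map_polyC /= hornerD hornerN hornerX hornerC.
    by rewrite invr1 subrr.
  have e : b = -1.
    have /eqP := two; rewrite -subr_eq0 subr_sqr_1 mulf_eq0 subr_eq0 addr_eq0.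
    by case/orP => /eqP // b1; have := prim_order_dvd prk 1; rewrite b1 expr1n eqxx.
  rewrite e /= rmorphD /= map_polyX map_polyC /= hornerD hornerX hornerC.
  by rewrite invrN1 -opprD addNr.
move=> k2; have bV : (map_poly intr 'Phi_k).[b^-1] = 0.
  move: bk; rewrite !CTpoly_spec ?invr_eq0 // invrK [b^-1 + b]addrC => /eqP.
  by rewrite mulf_eq0 expf_eq0 (negPf b0) andbF => /eqP ->; rewrite mulr0.
have bVb : b != b^-1.
  apply/eqP => e; have : b ^+ 2 = 1 by rewrite expr2 {1}e mulVf.
  move=> /eqP; rewrite -subr_eq0 subr_sqr_1 mulf_eq0 subr_eq0 addr_eq0 => h.
  have [c cE] : exists c : rat, b = ratr c.
    by case/orP: h => /eqP ->; [exists 1; rewrite rmorph1 | exists (-1); rewrite rmorphN1].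
  have m1 : is_minpoly b ('X - c%:P).
    split; [exact: monicXsubC | exact: irredp_XsubC |].
    by rewrite rmorphB /= map_polyX map_polyC /= -cE root_XsubC.
  have := totient_even k2; have := size_Cyclotomic k.
  rewrite -(size_map_inj_poly (f := intr : int -> rat)) //; last exact: intr_inj.
  by rewrite -(minpoly_uniq m1 (mb _ bk)) size_XsubC => -[<-].
rewrite -degQ_trace //; last by exists (map_poly intr 'Phi_k); apply: mb.
rewrite (degQ_minpoly (mb _ bk)) size_map_inj_poly //; last exact: intr_inj.
by rewrite size_Cyclotomic.
Qed.

(** * Real sums u + 1/u on either side of 2 *)

Lemma exists_addV (C : numClosedFieldType) (p : C) :
  exists2 a : C, a != 0 & a + a^-1 = p.
Proof.
pose r := sqrtC (p ^+ 2 - 4); have rr : r ^+ 2 = p ^+ 2 - 4 by apply: sqrtCK.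
pose a := (p + r) / 2; pose b := (p - r) / 2.
have ab : a * b = 1.
  have -> : a * b = (p ^+ 2 - r ^+ 2) / 4 by rewrite /a /b; field.
  by rewrite rr; field.
have a0 : a != 0.
  by apply: contraPneq ab => ->; rewrite mul0r => /esym/eqP; rewrite oner_eq0.
exists a => //; have -> : a^-1 = b by rewrite -[LHS]mulr1 -ab mulKf.
by rewrite /a /b; field.
Qed.

Lemma unit_circle (R : rcfType) (p : R) : -2 <= p <= 2 ->
  exists a : R[i], [/\ a != 0, a + a^-1 = (p%:C)%C & `|a| = 1].
Proof.
move=> p2; have s0 : 0 <= 1 - (p / 2) ^+ 2 by nra.
pose s := Num.sqrt (1 - (p / 2) ^+ 2).
have ss : s ^+ 2 = 1 - (p / 2) ^+ 2 by apply: sqr_sqrtr.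
pose a : R[i] := (p / 2 +i* s)%C; pose b : R[i] := (p / 2 -i* s)%C.
have ab : a * b = 1.
  apply/eqP; rewrite eq_complex /=.
  by apply/andP; split; apply/eqP; [rewrite -/s; nra | ring].
have a0 : a != 0.
  by apply: contraPneq ab => ->; rewrite mul0r => /esym/eqP; rewrite oner_eq0.
have aV : a^-1 = b by rewrite -[LHS]mulr1 -ab mulKf.
exists a; split=> //.
  rewrite aV; apply/eqP; rewrite eq_complex /= addrN eqxx andbT.
  by apply/eqP; field.
by apply/eqP; rewrite eq_complex /= -/s ss addrC subrK sqrtr1 !eqxx.
Qed.

Lemma horner_intr_real (R : rcfType) (h : {poly int}) (y : R) :
  ((map_poly intr h).[y]%:C)%C = (map_poly intr h).[(y%:C)%C] :> R[i].
Proof.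
rewrite -horner_map -map_poly_comp.
by congr (_.[_]); apply: eq_map_poly => c /=; rewrite rmorph_int.
Qed.

(** On the unit circle p = a + 1/a gives H_n(p) = a^n + a^-n, a sum of two
    numbers of modulus 1. *)
Lemma Hpoly_le2 (R : rcfType) (p : R) (n : nat) : -2 <= p <= 2 ->
  (map_poly intr (Hpoly n)).[p] <= 2.
Proof.
move=> /unit_circle[a [a0 ap a1]]; set x := _.[p].
have xE : (x%:C)%C = a ^+ n + a ^- n.
  by rewrite -Hpoly_spec // ap -horner_intr_real.
have xr : (x%:C)%C \is Num.real.
  by rewrite realE -(rmorph0 (real_complex R)) !lecR -realE num_real.
rewrite -lecR; apply: le_trans (real_ler_norm xr) _.
rewrite xE; apply: le_trans (ler_normD _ _) _.
by rewrite normfV !normrX a1 expr1n invr1 rmorphD rmorph1.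
Qed.

Lemma addV_gt2 (R : realFieldType) (c : R) : 0 < c -> c != 1 -> 2 < c + c^-1.
Proof.
move=> c0 c1; have d0 : 0 < c^-1 by rewrite invr_gt0.
have cd : c * c^-1 = 1 by rewrite divff ?gt_eqF.
have : 0 < (c - 1) ^+ 2 by rewrite exprn_even_gt0 //= subr_eq0.
move: cd d0; move: c^-1 => d cd d0 h.
(* c + 1/c - 2 = (c - 1)^2 / c *)
have -> : c + d = 2 + d * (c - 1) ^+ 2.
  by rewrite sqrrB1 mulrDr mulrBr expr2 mulrA [d * c]mulrC cd; ring: cd.
by rewrite ltrDl mulr_gt0.
Qed.

Lemma not_root1_gt1 (R : realFieldType) (c : R) : 1 < c -> not_root1 c.
Proof.
move=> c1 n; have c0 : 0 < c by apply: lt_trans c1.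
case: n => n.
  case: n => // n /eqP; rewrite -exprnP gt_eqF // exprn_egt1 //.
by rewrite NegzE -invr_expz -exprnP => /eqP; rewrite invr_eq1 gt_eqF // exprn_egt1.
Qed.

(** * Multiplicative dependence over the real conjugate *)

Lemma transferXz (F F' : numFieldType) (x : F) (y : F') u v (n : int) :
  coconj x y -> transfer x y u v -> transfer x y (u ^ n) (v ^ n).
Proof.
move=> xy uv; case: n => n; first exact: transferX.
by rewrite NegzE -!invr_expz; apply: transferV => //; exact: transferX.
Qed.

(** [lh] and [sd] are the square roots of lambda and delta, [al] is alpha, and
    [p] is the real counterpart of al + 1/al. *)
Section RealConjugate.
Variables (R : realType) (lh p : R) (sd al : R[i]) (m : nat).
Hypotheses (lh1 : 1 < lh) (xy : coconj lh sd) (al0 : al != 0) (m0 : (0 < m)%N).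
Hypothesis tp : transfer lh sd p (al + al^-1).

Let lh0 : lh != 0. Proof. by rewrite gt_eqF // (lt_trans _ lh1). Qed.

Lemma conj_neq0 : sd != 0.
Proof. by rewrite -(transfer0 xy (transfer_id lh sd)). Qed.

Lemma conj_not_root1 : not_root1 sd.
Proof.
move=> n e; apply: (not_root1_gt1 lh1).
apply/(transfer_eq xy (transferXz n xy (transfer_id lh sd)) (transfer_int _ _ 1)).
by rewrite e.
Qed.

(** Both equations express H_N and H_M of corresponding numbers, and the
    isomorphism preserves equality. *)
Lemma relation_iff (N M : int) :
  (map_poly intr (Hpoly `|N|)).[p] = lh ^ M + lh ^ (- M) <->
  al ^ N + al ^ (- N) = sd ^ M + sd ^ (- M).
Proof.
rewrite -(Hpoly_int N al0); apply: (transfer_eq xy).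
  exact: transfer_hornerz.
by apply: transferD; apply: transferXz => //; exact: transfer_id.
Qed.

Lemma mult_dep_real :
  mult_dep (sd ^+ m * al) (sd ^+ m * al^-1) <->
  exists (N : nat) (M : int),
    (0 < N)%N /\ (map_poly intr (Hpoly N)).[p] = lh ^ M + lh ^ (- M).
Proof.
have sd0 := conj_neq0.
rewrite mult_depP //; last exact: conj_not_root1.
split=> [[N [M [N0 e]]]|[N [M [N0 /(relation_iff N%:Z) e]]]].
  exists N, M; split=> //; apply/(relation_iff N%:Z).
  by rewrite -!invr_expz e.
move: e; rewrite -!invr_expz => /addV_eq[||e|e]; rewrite ?expfz_neq0 //.
  by exists N, M.
by exists N, (- M); rewrite -invr_expz.
Qed.

(** H_N(p) <= 2, and lh^M + lh^-M > 2 unless M = 0. *)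
Lemma mult_dep_small : -2 <= p <= 2 ->
  mult_dep (sd ^+ m * al) (sd ^+ m * al^-1) <->
  exists2 N, (0 < N)%N & (map_poly intr (Hpoly N)).[p] = 2.
Proof.
move=> p2; rewrite mult_dep_real.
split=> [[N [M [N0 e]]]|[N N0 e]]; exists N => //; last first.
  by exists 0; rewrite oppr0 expr0z.
have := Hpoly_le2 N p2; rewrite e -invr_expz.
have [->|M1] := eqVneq (lh ^ M) 1; first by rewrite invr1.
by rewrite leNgt addV_gt2 // exprz_gt0 // (lt_trans _ lh1).
Qed.

(** Here [al] is a root of unity, so a resonance would make the power
    m (n1 + n2 - 1) > 0 of [sd] a root of unity as well. *)
Lemma non_resonant_small : -2 <= p <= 2 ->
  mult_dep (sd ^+ m * al) (sd ^+ m * al^-1) ->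
  non_resonant (sd ^+ m * al) (sd ^+ m * al^-1).
Proof.
move=> p2 /(mult_dep_small p2)[N N0 e].
have alN : al ^ N%:Z = 1.
  have /(relation_iff N%:Z) : (map_poly intr (Hpoly `|N%:Z|)).[p] = lh ^ 0 + lh ^ (- 0).
    by rewrite e oppr0 expr0z.
  rewrite oppr0 -invr_expz expr0z => e2.
  have : al ^ N + (al ^ N)^-1 = 1 + 1^-1 by rewrite invr1.
  by case/addV_eq; rewrite ?expfz_neq0 ?oner_eq0 // invr1.
have sd0 := conj_neq0; apply/non_resonantP => // n1 n2 n12.
have no (x : int) : al ^ x <> sd ^ (m%:Z * (n1%:Z + n2%:Z - 1)).
  move=> h; have : sd ^ (m%:Z * (n1%:Z + n2%:Z - 1) * N%:Z) = 1.
    by rewrite -exprz_exp -h exprzAC alN exp1rz.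
  move/conj_not_root1/eqP; rewrite !mulf_eq0 => /orP[/orP[]|] /eqP; lia.
by split; apply: no.
Qed.

End RealConjugate.

Lemma degQ_real (R : rcfType) (x : R) : degQ (x%:C)%C = degQ x.
Proof.
rewrite /degQ /minpoly; suff -> : is_minpoly (x%:C)%C = is_minpoly x by [].
by apply/funext => q; apply/propext/minpoly_real.
Qed.

(** Write p = a + 1/a; then a^2 + a^-2 = p^2 - 2, so that [b] is a^2 or its
    inverse. *)
Lemma root1_small (R : realType) (p : R) (b : R[i]) :
    b != 0 -> b + b^-1 = ((p ^+ 2 - 2)%:C)%C ->
  (exists2 N, (0 < N)%N & (map_poly intr (Hpoly N)).[p] = 2) <->
  (exists2 N, (0 < N)%N & b ^+ N = 1).
Proof.
move=> b0 bQ; have [a a0 ap] := exists_addV ((p%:C)%C : R[i]).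
have HN N : (map_poly intr (Hpoly N)).[p] = 2 <-> a ^+ N = 1.
  have -> : (map_poly intr (Hpoly N)).[p] = 2 <-> a ^+ N + (a ^+ N)^-1 = 1 + 1^-1.
    rewrite -Hpoly_spec // ap -horner_intr_real invr1.
    split=> [->|e]; first by rewrite rmorphD rmorph1.
    by apply: (fmorph_inj (real_complex R)); rewrite /= e rmorphD rmorph1.
  rewrite addV_eq ?expf_neq0 ?oner_eq0 // invr1.
  by split=> [[]|] //; left.
have ba : b = a ^+ 2 \/ b = (a ^+ 2)^-1.
  apply/addV_eq; rewrite ?expf_neq0 // bQ rmorphB rmorphXn rmorph_nat /= -ap.
  by rewrite sqrrD mulfV // exprVn addrAC addrK.
have bN N : b ^+ N = 1 <-> a ^+ (2 * N) = 1.
  case: ba => ->; rewrite ?exprVn -exprM //.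
  by split=> [/(congr1 GRing.inv)|->]; rewrite ?invrK invr1.
split=> -[N N0].
  by move/HN => aN; exists N => //; apply/bN; rewrite mulnC exprM aN expr1n.
by move/bN => aN; exists (2 * N)%N; [rewrite muln_gt0 | apply/HN].
Qed.

(** * Salem numbers as powers *)

Lemma coconj_trans (F F' F'' : numFieldType) (x : F) (y : F') (z : F'') :
  coconj x y -> coconj y z -> coconj x z.
Proof. by move=> [p px py] [q qy qz]; exists p; rewrite // (minpoly_uniq py qy). Qed.

Lemma coconj_real (R : rcfType) (F : numFieldType) (x : R) (z : F) :
  coconj (x%:C)%C z <-> coconj x z.
Proof. by split=> -[p /minpoly_real px pz]; exists p => //; apply/minpoly_real. Qed.

Lemma conjugate_real (R : rcfType) (x : R) (z : R[i]) :
  conjugate (x%:C)%C z <-> coconj x z.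
Proof.
by split=> [/conjugate_coconj/coconj_real|/coconj_real/coconj_conjugate].
Qed.

(** A nonzero polynomial of least degree vanishing at [x] is irreducible. *)
Lemma algebraic_coconj (F : numFieldType) (x : F) (g : {poly rat}) :
  g != 0 -> root (map_poly ratr g) x -> coconj x x.
Proof.
move=> g0 gx.
pose P n := `[< exists2 f : {poly rat}, f != 0 /\ root (map_poly ratr f) x & size f = n >].
have exP : exists n, P n by exists (size g); apply/asboolP; exists g.
case: (ex_minnP exP) => n /asboolP[f [f0 fx] fn] nmin {g g0 gx}.
have lf0 : (lead_coef f)^-1 != 0 by rewrite invr_eq0 lead_coef_eq0.
pose p := (lead_coef f)^-1 *: f.
have pn : size p = n by rewrite size_scale.
have p0 : p != 0 by rewrite -size_poly_eq0 pn -fn size_poly_eq0.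
have px : root (map_poly ratr p) x by rewrite map_polyZ rootZ // fmorph_eq0.
have minp (h : {poly rat}) : h != 0 -> root (map_poly ratr h) x -> (size p <= size h)%N.
  by move=> h0 hx; rewrite pn; apply: nmin; apply/asboolP; exists h.
suff pI : irreducible_poly p.
  by exists p; split=> //; rewrite monicE lead_coefZ mulVf // lead_coef_eq0.
split=> [|h h1 hp].
  rewrite ltnNge; apply/negP => /size1_polyC pC.
  move: px; rewrite pC map_polyC rootC fmorph_eq0 => c0.
  by move: p0; rewrite pC (eqP c0) eqxx.
have h0 : h != 0 by apply: contraTneq hp => ->; rewrite dvd0p.
case/dvdpP: (hp) => q pE; have q0 : q != 0 by apply: contraNneq p0 => e; rewrite pE e mul0r.
move: (px); rewrite {1}pE rmorphM rootM => /orP[/(minp _ q0)|/(minp _ h0) le].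
  have h2 : (1 < size h)%N by rewrite ltn_neqAle eq_sym h1 size_poly_gt0.
  rewrite {1}pE size_mul //.
  by case: (size h) h2 => [|[|l]] // _; rewrite !addnS /= ltnNge leq_addr.
by rewrite -dvdp_size_eqp // eqn_leq le andbT dvdp_leq.
Qed.

Lemma coprime_expr_eq1 (F : fieldType) (r : F) (j k : nat) :
  (0 < j)%N -> coprime j k -> r ^+ j = 1 -> r ^+ k = 1 -> r = 1.
Proof.
move=> j0 jk rj rk; case: (egcdnP k j0) => u v; rewrite (eqP jk) => e _.
have : r ^+ (u * j) = r ^+ (v * k + 1) by rewrite e.
by rewrite exprD !(mulnC _ j, mulnC _ k) !exprM rj rk !expr1n mul1r.
Qed.

Lemma coprime_expr_inj (F : fieldType) (x y : F) (j k : nat) :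
  (0 < j)%N -> coprime j k -> y != 0 -> x ^+ j = y ^+ j -> x ^+ k = y ^+ k -> x = y.
Proof.
move=> j0 jk y0 xj xk; apply: (mulIf (invr_neq0 y0)); rewrite divff //.
by apply: (coprime_expr_eq1 j0 jk); rewrite expr_div_n ?xj ?xk divff ?expf_neq0.
Qed.

(** Over the rationals an irreducible polynomial is separable, so [x] has as
    many conjugates as its degree. *)
Lemma exists_other_conjugate (C : numClosedFieldType) (F : numFieldType)
    (x : F) (u v : C) :
  coconj x x -> (3 <= degQ x)%N -> exists z : C, [/\ coconj x z, z != u & z != v].
Proof.
case=> p px _; rewrite (degQ_minpoly px) => deg; have [pm pI _] := px.
have sep : separable_poly p.
  have p0 := monic_neq0 pm.
  rewrite separable_poly.unlock irreducible_poly_coprime //; apply/negP => /dvdp_leq.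
  have szd : size p^`() = (size p).-1 by exact: polyorder.size_deriv.
  rewrite -size_poly_eq0 szd; case: (size p) deg => // n dn.
  by rewrite /= ltnn -lt0n (ltn_trans _ dn) // => /(_ isT).
have [r rE] := closed_field_poly_normal (map_poly ratr p : {poly C}).
have lc : lead_coef (map_poly ratr p : {poly C}) = 1.
  by apply/monicP; rewrite map_monic.
rewrite lc scale1r in rE.
have ru : uniq r by rewrite -separable_prod_XsubC -rE separable_map.
have sr : size r = (size p).-1.
  have := congr1 size (congr1 polyseq rE).
  by rewrite size_prod_XsubC size_map_poly => ->.
have [/allP rs|/allPn[z zr]] := boolP (all [in [:: u; v]] r).
  by have := uniq_leq_size ru rs; rewrite sr /= leqNgt deg.
rewrite !inE negb_or => /andP[zu zv]; exists z; split => //; exists p => //.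
by split=> //; rewrite rE root_prod_XsubC.
Qed.

(** In the application B = mu^j satisfies B + 1/B = Q(rho) with rho = mu^k + mu^-k,
    and [g] is a polynomial taking the same value as Q at rho. *)
Section SalemRoot.
Variables (R : realType) (lambda mu : R) (j k : nat) (g : {poly rat}).
Hypotheses (sal : is_salem lambda) (mu1 : 1 < mu) (j0 : (0 < j)%N) (k0 : (0 < k)%N).
Hypotheses (jk : coprime j k) (lE : lambda = mu ^+ k).
Hypothesis gE : mu ^+ j + mu ^- j = (map_poly ratr g).[mu ^+ k + mu ^- k].

Let mu0 : 0 < mu. Proof. exact: lt_trans mu1. Qed.
Let mun0 : mu != 0. Proof. exact: lt0r_neq0. Qed.

(* A conjugate z of mu with z^k = lambda has z^j + z^-j = mu^j + mu^-j; the
   sign of log |z| excludes z^j = mu^-j, and coprimality gives z = mu. *)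
Let only_mu (z : R[i]) : z ^+ k = (lambda%:C)%C ->
  z ^+ j + z ^- j = ((mu ^+ j + mu ^- j)%:C)%C -> z = (mu%:C)%C.
Proof.
move=> zk zj; have z0 : z != 0.
  apply/eqP => z0; move: zk; rewrite z0 expr0n gtn_eqF //= => /esym/eqP.
  by rewrite lE fmorph_eq0 expf_eq0 (negPf mun0) andbF.
have m0 : (mu%:C)%C != 0 :> R[i] by rewrite fmorph_eq0.
rewrite lE rmorphXn /= in zk.
move: zj; rewrite rmorphD fmorphV rmorphXn /=.
case/addV_eq; rewrite ?expf_neq0 // => zj; first exact: (coprime_expr_inj j0 jk m0 zj zk).
have e : (mu ^+ (k * j + j * k))%:C%C = 1 :> R[i].
  rewrite rmorphXn exprD !exprM /= -zk (exprAC z k j) zj exprVn mulVf //.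
  by rewrite expf_neq0 // expf_neq0.
have := fmorph_eq1 (real_complex R) (mu ^+ (k * j + j * k)).
rewrite /= e eqxx => /esym; rewrite gt_eqF //.
by rewrite exprn_egt1 // -lt0n addn_gt0 muln_gt0 k0 j0.
Qed.

(** The identity [gE] holds at every conjugate z of mu.  If z^k is lambda or
    its inverse, it determines z^j + z^-j and hence z; otherwise z^k, being a
    conjugate of lambda, has modulus 1. *)
Lemma salem_root_conj (z : R[i]) : coconj mu z ->
  [\/ z = (mu%:C)%C, z = (mu^-1%:C)%C | `|z| = 1].
Proof.
move=> muz; have tz := transfer_id mu z.
have z0 : z != 0 by rewrite -(transfer0 muz tz).
have zj : z ^+ j + z ^- j = (map_poly ratr g).[z ^+ k + z ^- k].
  have tS n : transfer mu z (mu ^+ n + mu ^- n) (z ^+ n + z ^- n).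
    by apply: transferD; [|apply: transferV] => //; apply: transferX.
  by apply/(transfer_eq muz (tS j) (transfer_horner g (tS k))).
have [_ _ _ sc _] := sal.
have lzk : conjugate (lambda%:C)%C (z ^+ k).
  by apply/conjugate_real; rewrite lE; apply: (transfer_coconj muz); exact: transferX.
have QE : ((mu ^+ j + mu ^- j)%:C)%C =
    (map_poly ratr g).[(lambda%:C)%C + (lambda%:C)^-1%C].
  rewrite gE -lE -horner_map -map_poly_comp rmorphD fmorphV.
  by congr (_.[_]); apply: eq_map_poly => c /=; rewrite fmorph_rat.
have [zl|/eqP zl] := eqVneq (z ^+ k) (lambda%:C)%C.
  by apply: Or31; apply: only_mu; rewrite ?QE // zj zl.
have [zV|/eqP zV] := eqVneq (z ^+ k) ((lambda^-1)%:C)%C.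
  apply: Or32; rewrite fmorphV -[LHS]invrK; congr _^-1; apply: only_mu.
    by rewrite exprVn zV fmorphV invrK.
  by rewrite QE -exprVn invrK exprVn addrC zj zV fmorphV invrK addrC.
apply: Or33; have := sc _ lzk zl zV; rewrite normrX => /eqP.
by rewrite pexpr_eq1 // ?normr_ge0 // => /eqP.
Qed.

(** Since deg mu >= deg lambda >= 4, some conjugate z of mu differs from mu and
    1/mu, so it lies on the unit circle; its complex conjugate 1/z is conjugate to
    it, whence 1/mu is conjugate to mu. *)
Lemma salem_root : is_salem mu.
Proof.
have [l1 [h hm hl] _ _ ld] := sal.
have hk : h \Po 'X^k \is monic.
  rewrite monicE lead_coef_comp ?size_polyXn ?ltnS //.
  by rewrite (monicP hm) lead_coefXn expr1n mulr1.
have cmu : coconj mu mu.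
  apply: (@algebraic_coconj _ _ (map_poly intr (h \Po 'X^k))).
    by apply: monic_neq0; exact: monic_map.
  rewrite ratr_intr_poly /root map_comp_poly horner_comp map_polyXn hornerXn.
  by rewrite -lE.
have deg : (4 <= degQ mu)%N.
  have d0 : (0 < degQ mu)%N.
    have [q mq _] := cmu; rewrite (degQ_minpoly mq).
    by case: mq => _ [] + _ _; case: size => [|[]].
  apply: leq_trans ld (dvdn_leq d0 _); have := degQ_dvd ('X^k) cmu.
  by rewrite map_polyXn hornerXn lE.
split=> //.
- exists (h \Po 'X^k) => //.
  by rewrite /root map_comp_poly horner_comp map_polyXn hornerXn -lE.
- apply/conjugate_real.
  have [z [muz z1 z2]] := exists_other_conjugate (mu%:C)%C (mu^-1%:C)%C cmu (ltnW deg).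
  have nz : `|z| = 1.
    by case: (salem_root_conj muz) => // e; rewrite e eqxx in z1 z2.
  have zc : z^* = z^-1.
    have z0 : z != 0 by rewrite -normr_eq0 nz oner_eq0.
    by apply: (mulfI z0); rewrite -normCK nz expr1n divff.
  have czz : coconj z z^*.
    have [q _ mq] := muz; exists q => //; case: mq => qm qI qz; split=> //.
    rewrite -(fmorph_root (@Num.conj R[i])) in qz.
    move: qz; rewrite -map_poly_comp.
    by congr (root _ _); apply: eq_map_poly => c /=; rewrite fmorph_rat.
  have muV : coconj mu^-1 z^-1.
    by apply: (transfer_coconj muz); apply: transferV => //; exact: transfer_id.
  rewrite zc in czz.
  apply: coconj_trans (coconj_trans muz czz) _.
  by apply/coconj_sym/coconj_real.
- by move=> z /conjugate_real/salem_root_conj[].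
Qed.

End SalemRoot.

(** * The relation between rho and Q(rho) when Q(rho) exceeds 2 *)

(** H_n(H_2(p)) = H_2(H_n(p)), since taking n-th powers and squaring commute. *)
Lemma Hpoly_sqr (R : rcfType) (p : R) (n : nat) :
  (map_poly intr (Hpoly n)).[p ^+ 2 - 2] = (map_poly intr (Hpoly n)).[p] ^+ 2 - 2.
Proof.
have [a a0 ap] := exists_addV ((p%:C)%C : R[i]).
have sqV (u : R[i]) : u != 0 -> (u + u^-1) ^+ 2 - 2 = u ^+ 2 + (u ^+ 2)^-1.
  by move=> u0; rewrite sqrrD mulfV // exprVn addrAC addrK.
apply: (fmorph_inj (real_complex R)).
rewrite /= horner_intr_real !rmorphB !rmorphXn !rmorph_nat /= horner_intr_real -ap sqV //.
by rewrite !Hpoly_spec ?expf_neq0 // sqV ?expf_neq0 // exprAC.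
Qed.

Lemma exists_addV_gt1 (R : rcfType) (q : R) : 2 < q ->
  exists2 B : R, 1 < B & B + B^-1 = q.
Proof.
move=> q2; pose r := Num.sqrt (q ^+ 2 - 4).
have r0 : 0 <= r by apply: sqrtr_ge0.
have rr : r ^+ 2 = q ^+ 2 - 4 by apply: sqr_sqrtr; nra.
pose a := (q + r) / 2; pose b := (q - r) / 2.
have a1 : 1 < a by rewrite /a; lra.
have ab : a * b = 1.
  have -> : a * b = (q ^+ 2 - r ^+ 2) / 4 by rewrite /a /b; field.
  by rewrite rr; field.
have a0 : a != 0 by rewrite gt_eqF // (lt_trans _ a1).
exists a => //; have -> : a^-1 = b by rewrite -[LHS]mulr1 -ab mulKf.
by rewrite /a /b; field.
Qed.

Lemma addV_gt1_inj (R : realFieldType) (u v : R) : 1 < u -> 1 < v ->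
  u + u^-1 = v + v^-1 -> u = v.
Proof.
move=> u1 v1; have u0 := lt_trans ltr01 u1; have v0 := lt_trans ltr01 v1.
case/addV_eq; rewrite ?lt0r_neq0 // => uv.
by have := invf_lt1 v0; rewrite -uv v1 ltNge (ltW u1).
Qed.

(** The common base is found by Bezout: if u k = v j + 1 then lambda^u / B^v
    has k-th power lambda and j-th power B. *)
Lemma common_base (R : realFieldType) (lambda B : R) (N M : nat) :
    1 < lambda -> 1 < B -> (0 < N)%N -> (0 < M)%N -> B ^+ N = lambda ^+ M ->
  exists j k mu, [/\ (0 < j)%N /\ (0 < k)%N, coprime j k, 1 < mu,
    lambda = mu ^+ k & B = mu ^+ j].
Proof.
move=> l1 B1 N0 M0 e; have l0 := lt_trans ltr01 l1; have B0 := lt_trans ltr01 B1.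
pose d := gcdn M N; have d0 : (0 < d)%N by rewrite gcdn_gt0 M0.
pose j := (M %/ d)%N; pose k := (N %/ d)%N.
have jE : (j * d)%N = M by rewrite divnK ?dvdn_gcdl.
have kE : (k * d)%N = N by rewrite divnK ?dvdn_gcdr.
have j0 : (0 < j)%N by move: M0; rewrite -jE muln_gt0 => /andP[].
have k0 : (0 < k)%N by move: N0; rewrite -kE muln_gt0 => /andP[].
have jk : coprime j k.
  by rewrite /coprime -(eqn_pmul2r d0) muln_gcdl jE kE mul1n.
have {}e : B ^+ k = lambda ^+ j.
  apply/eqP; rewrite -(eqrXn2 d0) ?exprn_ge0 ?ltW //.
  by rewrite -!exprM jE kE e.
case: (egcdnP j k0) => u v; rewrite gcdnC (eqP jk) => uv _.
have B0' : B != 0 by rewrite lt0r_neq0.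
pose mu := lambda ^+ u / B ^+ v; have muk : mu ^+ k = lambda.
  rewrite /mu expr_div_n -!exprM [(v * k)%N]mulnC uv exprM exprD expr1 !exprM e.
  by rewrite -exprM mulnC exprM mulrC mulKf // !expf_neq0 // lt0r_neq0.
have muj : mu ^+ j = B.
  rewrite /mu expr_div_n -!exprM [(u * j)%N]mulnC exprM -e -exprM.
  by rewrite [(k * u)%N]mulnC uv exprD expr1 mulrC mulKf // expf_neq0.
exists j, k, mu; split=> //.
have mu0 : 0 < mu by rewrite divr_gt0 ?exprn_gt0.
by rewrite ltNge; apply/negP => /(exprn_ile1 k (ltW mu0)); rewrite muk leNgt l1.
Qed.

(** As before [lh] is the square root of lambda and p = Phat(rhohat); [g] is a
    polynomial with the value of Q at rho. *)
Section Large.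
Variables (R : realType) (lh p : R) (g : {poly rat}).
Hypotheses (lh1 : 1 < lh) (sal : is_salem (lh ^+ 2)) (p2 : 2 < p ^+ 2 - 2).
Let lambda := lh ^+ 2.
Let rho := lambda + lambda^-1.
Hypothesis gE : p ^+ 2 - 2 = (map_poly ratr g).[rho].

Let l1 : 1 < lambda. Proof. by rewrite exprn_egt1. Qed.

Definition salem_solution (j k : nat) (sigma : R) :=
  [/\ (0 < j)%N /\ (0 < k)%N, coprime j k, is_salem_trace sigma,
    (map_poly intr (Hpoly j)).[sigma] = p ^+ 2 - 2
    & rho = (map_poly intr (Hpoly k)).[sigma]].

Lemma salem_solutionP j k sigma : salem_solution j k sigma ->
  exists mu, [/\ 1 < mu, sigma = mu + mu^-1, mu ^+ k = lambda,
    mu ^+ j + (mu ^+ j)^-1 = p ^+ 2 - 2 & [/\ (0 < j)%N, (0 < k)%N & coprime j k]].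
Proof.
case=> [[j0 k0] jk [mu smu ->]]; have [mu1 _ _ _ _] := smu.
have mu0 : mu != 0 by rewrite gt_eqF // (lt_trans _ mu1).
rewrite !Hpoly_spec // => e /(addV_gt1_inj l1) l; exists mu; split=> //.
by rewrite l // exprn_egt1 // -lt0n.
Qed.

(** Here a = s mu^(j/2) with s the sign of [p]: the square of mu^(j/2) + mu^(-j/2)
    is mu^j + mu^-j + 2 = p^2. *)
Lemma real_parameter (mu : R) (j : nat) :
    1 < mu -> mu ^+ j + (mu ^+ j)^-1 = p ^+ 2 - 2 ->
  exists nu, [/\ 1 < nu, nu ^+ 2 = mu &
    let a := (-1) ^+ (p < 0)%R * nu ^+ j in a + a^-1 = p].
Proof.
move=> mu1 muj; have mu0 := lt_trans ltr01 mu1; pose nu := Num.sqrt mu.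
have nu2 : nu ^+ 2 = mu by rewrite sqr_sqrtr // ltW.
have nu0 : 0 < nu by rewrite sqrtr_gt0.
have nu1 : 1 < nu.
  by rewrite ltNge; apply/negP => /(exprn_ile1 2 (ltW nu0)); rewrite nu2 leNgt mu1.
exists nu; split=> //=; set c := nu ^+ j; have c0 : 0 < c by apply: exprn_gt0.
have cV : 0 < c^-1 by rewrite invr_gt0.
rewrite invfM invr_sign -mulrDr [RHS]realEsign ?num_real //; congr (_ * _).
apply/eqP; rewrite -(eqrXn2 (isT : (0 < 2)%N)) ?normr_ge0 ?addr_ge0 ?ltW //.
rewrite -normrX ger0_norm ?sqr_ge0 // sqrrD mulfV ?lt0r_neq0 // exprVn.
by rewrite /c exprAC nu2 addrAC muj subrK.
Qed.

(** A relation H_N(p) = H_M(rhohat) gives B^N = lambda^M or B^N = lambda^-M by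
    applying H_2 to both sides; the exponent of lambda is positive because
    B^N > 1.  Conversely H_2k(p) and H_2j(rhohat) both equal mu^(jk) + mu^(-jk). *)
Lemma large_relation :
  (exists (N : nat) (M : int),
    (0 < N)%N /\ (map_poly intr (Hpoly N)).[p] = lh ^ M + lh ^ (- M)) <->
  exists j k sigma, salem_solution j k sigma.
Proof.
have lh0 : lh != 0 by rewrite gt_eqF // (lt_trans _ lh1).
have [B B1 BE] := exists_addV_gt1 p2.
have B0 : B != 0 by rewrite gt_eqF // (lt_trans _ B1).
have l0 : lambda != 0 by rewrite expf_neq0.
split=> [[N [M [N0 e]]]|[j [k [sigma /salem_solutionP[mu [mu1 _ muk muj [j0 k0 jk]]]]]]].
  have : B ^+ N + (B ^+ N)^-1 = lambda ^ M + (lambda ^ M)^-1.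
    rewrite -Hpoly_spec // BE Hpoly_sqr e -!invr_expz sqrrD mulfV ?expfz_neq0 //.
    rewrite exprVn addrAC addrK /lambda !exprnP !exprz_exp.
    by rewrite [M * _]mulrC.
  have BN1 : 1 < B ^+ N by rewrite exprn_egt1 // -lt0n.
  move=> h; have [K K0 {}h] : exists2 K : nat, (0 < K)%N & B ^+ N = lambda ^+ K.
    have pos (K : int) : B ^+ N = lambda ^ K ->
        exists2 K : nat, (0 < K)%N & B ^+ N = lambda ^+ K.
      case: K => [[|K]|K] BK; last 2 first.
      - by exists K.+1.
      - have lK : 1 < lambda ^+ K.+1 by rewrite exprn_egt1.
        move: BN1; rewrite BK NegzE -invr_expz -exprnP.
        by rewrite invf_gt1 ?(lt_trans ltr01) // ltNge (ltW lK).
      - by move: BN1; rewrite BK expr0z ltxx.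
    case/addV_eq: h; rewrite ?expf_neq0 ?expfz_neq0 //; first exact: pos.
    by rewrite invr_expz; exact: pos.
  have [j [k [mu [[j0 k0] jk mu1 lE Bj]]]] := common_base l1 B1 N0 K0 h.
  have mu0 : mu != 0 by rewrite gt_eqF // (lt_trans _ mu1).
  exists j, k, (mu + mu^-1); split; rewrite ?Hpoly_spec -?Bj -?lE //.
  exists mu => //; apply: (salem_root (g := g) sal mu1 j0 k0 jk lE).
  by rewrite -Bj -lE BE gE.
have [b bE] : exists b : R, [/\ b != 0, b + b^-1 = p & b ^+ 2 = mu ^+ j].
  have [nu [nu1 numu pE]] := real_parameter mu1 muj.
  exists ((-1) ^+ (p < 0)%R * nu ^+ j); split; last by rewrite exprMn sqrr_sign mul1r exprAC numu.
    by rewrite mulf_neq0 ?signr_eq0 // expf_neq0 // gt_eqF // (lt_trans _ nu1).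
  by [].
exists (2 * k)%N, (2 * j%:Z); rewrite muln_gt0 k0; split=> //.
case: bE => b0 <- bj; rewrite Hpoly_spec // exprM bj -invr_expz.
rewrite -exprz_exp -!exprnP -/lambda -muk -!exprM [(j * k)%N]mulnC.
by [].
Qed.

(** The two expressions B = mu^j = nu^j' and lambda = mu^k = nu^k' give
    j / k = j' / k', two reduced fractions. *)
Lemma salem_solution_uniq j k sigma j' k' sigma' :
  salem_solution j k sigma -> salem_solution j' k' sigma' ->
  [/\ j = j', k = k' & sigma = sigma'].
Proof.
move=> /salem_solutionP[mu [mu1 -> muk muj [j0 k0 jk]]].
move=> /salem_solutionP[nu [nu1 -> nuk nuj [j0' k0' jk']]].
have mu0 := lt_trans ltr01 mu1; have nu0 := lt_trans ltr01 nu1.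
have kk : mu ^+ k = nu ^+ k' by rewrite muk nuk.
have jj : mu ^+ j = nu ^+ j'.
  by apply: addV_gt1_inj; rewrite ?exprn_egt1 -?lt0n // muj nuj.
have e : (j * k' = k * j')%N.
  have : mu ^ (j * k')%N%:Z = mu ^ (k * j')%N%:Z.
    by rewrite -!exprnP !exprM jj kk exprAC.
  by case/(not_root1_inj (lt0r_neq0 mu0) (not_root1_gt1 mu1)).
have jE : j = j'.
  apply/eqP; rewrite eqn_dvd -(Gauss_dvdr j' jk) -e dvdn_mulr //=.
  by rewrite -(Gauss_dvdl j jk') e dvdn_mull.
have kE : k = k'.
  by apply/eqP; move/eqP: e; rewrite jE mulnC eqn_pmul2r // eq_sym.
split=> //; suff -> : mu = nu by [].
by apply/eqP; rewrite -(eqrXn2 k0) ?ltW // kk -kE.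
Qed.

End Large.

(** * Resonances *)

(** Both sides are up to sign powers of nu > 1; the right one is positive, so
    for a negative base the exponent [x] must be even. *)
Lemma signed_relation (R : realFieldType) (nu : R) (b : bool) (j k : nat)
    (x y : int) :
  1 < nu ->
  ((-1) ^+ b * nu ^+ j) ^ x = (nu ^+ k) ^ y <->
  j%:Z * x = k%:Z * y /\ (b -> (2 %| x)%Z).
Proof.
move=> nu1; have nu0 : 0 < nu := lt_trans ltr01 nu1.
rewrite expfzMl !exprnP !exprz_exp.
have nun : nu != 0 by rewrite lt0r_neq0.
have pow : nu ^ (j%:Z * x) = nu ^ (k%:Z * y) <-> j%:Z * x = k%:Z * y.
  split=> [|->//]; apply: (not_root1_inj nun); exact: not_root1_gt1.
have [[z xz]|[z xz]] : (exists z, x = 2 * z) \/ (exists z, x = 2 * z + 1).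
- have [e|e] : x = 2 * (x %/ 2)%Z \/ x = 2 * (x %/ 2)%Z + 1 by lia.
    by left; exists (x %/ 2)%Z.
  by right; exists (x %/ 2)%Z.
- have -> : (-1) ^ ((b : nat)%:Z * x) = 1 :> R.
    by rewrite xz mulrCA -exprz_exp -exprnP sqrrN expr1n exp1rz.
  rewrite mul1r pow; split=> [->|[]//]; split=> // _.
  by rewrite xz dvdz_mulr.
have dx : (2 %| x)%Z = false by lia.
case: b => /=; last first.
  by rewrite mul0r expr0z mul1r pow; split=> [->|[]].
rewrite mul1r dx xz expfzDr ?oppr_eq0 ?oner_eq0 // -exprz_exp -exprnP sqrrN expr1n.
rewrite exp1rz expr1z !mul1r mulN1r; split=> [e|[_ /(_ isT)]//].
have : 0 < nu ^ (k%:Z * y) by apply: exprz_gt0.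
by rewrite -e oppr_gt0 ltNge ltW // exprz_gt0.
Qed.

(** With A = k m + j, the two resonance equations are A (n1 - 1) + Delta n2 = 0
    and A n1 + Delta (n2 - 1) = 0.  For Delta > 0 the only solutions with
    n1 + n2 >= 2 have n1 = 0 and Delta (n2 + 1) = 2 k m.  Since Delta is prime to k
    (because j is), this requires 2 m = Delta f, and then n2 + 1 = k f.  When
    Delta does not divide m, f is odd and Delta is even, which forces k to be odd
    (otherwise j would be even too): the parity condition on n2 + 1 then fails,
    and the resonance occurs only in the absence of a sign. *)
Lemma resonance_arith (j k m : nat) (b : bool) :
    (0 < j)%N -> (0 < k)%N -> (0 < m)%N -> coprime j k ->
  let Delta : int := (k * m)%N%:Z - j%:Z in
  (forall n1 n2 : nat, (2 <= n1 + n2)%N ->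
    ~ (j%:Z * (1 - n1%:Z + n2%:Z) = k%:Z * (m%:Z * (n1%:Z + n2%:Z - 1)) /\
       (b -> (2 %| 1 - n1%:Z + n2%:Z)%Z)) /\
    ~ (j%:Z * (- 1 - n1%:Z + n2%:Z) = k%:Z * (m%:Z * (n1%:Z + n2%:Z - 1)) /\
       (b -> (2 %| - 1 - n1%:Z + n2%:Z)%Z))) <->
  [/\ 2 <= Delta, ~~ (Delta %| m%:Z)%Z
    & (2 %| Delta)%Z -> (Delta %| (2 * m)%N%:Z)%Z ->
      ~~ (2 %| ((2 * m)%N%:Z %/ Delta)%Z)%Z -> b].
Proof.
move=> j0 k0 m0 jk Delta.
have odd_coprime (f : int) : ~~ (2 %| f)%Z -> coprimez 2 f.
  by rewrite coprimezE prime_coprime // dvdzE.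
have par (e : int) : (2 %| 2 * e)%Z by exact: dvdz_mulr.
have cop : coprimez Delta k%:Z.
  rewrite /coprimez gcdzC /Delta PoszM [k%:Z * _]mulrC gcdzMDl gcdzN.
  by rewrite gcdzC -/(coprimez _ _) coprimezE.
split=> [H|[N1 N2 N3] n1 n2 n12].
  have H1 n2 : Delta * (n2%:Z + 1) = 2 * (k%:Z * m%:Z) -> 0 < Delta ->
      (b -> (2 %| n2%:Z + 1)%Z) -> False.
    move=> e D0 bp; have n2_2 : (2 <= n2)%N.
      rewrite leqNgt; apply/negP => n2_2.
      rewrite /Delta PoszM in e D0; nia.
    have [h _] := H 0%N n2 n2_2; apply: h; split; last by move/bp; rewrite subr0 addrC.
    move: e; rewrite /Delta PoszM; lia.
  have D0 : 0 < Delta.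
    rewrite ltNge; apply/negP => D0.
    (* With D = -Delta >= 0, A (n1 - 1) = 2 D A = D n2; the factor 2 takes care of
       the parity condition. *)
    pose D := absz Delta; have DE : D%:Z = - Delta by rewrite /D; lia.
    have [|h _] := H (1 + 2 * D)%N (2 * (k * m + j))%N; first by lia.
    apply: h; split=> [|_]; rewrite !(PoszD, PoszM) DE.
      rewrite /Delta PoszM; lia.
    by apply/dvdzP; exists (Delta + (k * m)%N%:Z + j%:Z); lia.
  have two (e : int) (n2 : nat) : n2%:Z + 1 = 2 * e -> b -> (2 %| n2%:Z + 1)%Z.
    by move=> -> _; exact: par.
  have nd : ~~ (Delta %| m%:Z)%Z.
    apply/negP => /dvdzP[f fE].
    have f0 : 0 < f by nia.
    pose n2 := absz (2 * (k%:Z * f) - 1)%R.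
    have n2E : n2%:Z + 1 = 2 * (k%:Z * f) by rewrite /n2; nia.
    apply: (H1 n2) => //; last exact: two n2E.
    by rewrite n2E fE; ring.
  split=> //.
    (* Delta = 1 divides m. *)
    have [D1|//] : Delta = 1 \/ 2 <= Delta by lia.
    by rewrite D1 dvd1z in nd.
  move=> _ /dvdzP[e eE] _; apply/negPn/negP => nb.
  have e0 : 0 < e by nia.
  pose n2 := absz (k%:Z * e - 1)%R.
  have n2E : n2%:Z + 1 = k%:Z * e by rewrite /n2; nia.
  apply: (H1 n2) => //; last by move=> b1; rewrite b1 in nb.
  by rewrite n2E; move: eE; rewrite PoszM => eE; rewrite -mulrCA [2 * _]mulrCA eE; ring.
split=> -[e bp].
  have e' : ((k * m)%N%:Z + j%:Z) * (n1%:Z - 1) + Delta * n2%:Z = 0.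
    by rewrite /Delta PoszM; lia.
  have n1E : n1 = 0%N by nia.
  have e2 : Delta * (n2%:Z + 1) = 2 * (k%:Z * m%:Z).
    by move: e'; rewrite n1E /Delta PoszM; lia.
  have : (Delta %| (2 * m)%N%:Z)%Z.
    rewrite -(Gauss_dvdzr _ cop); apply/dvdzP; exists (n2%:Z + 1).
    by rewrite [RHS]mulrC e2 PoszM; ring.
  move=> D2m; case/dvdzP: (D2m) => f fE.
  have fV : ((2 * m)%N%:Z %/ Delta)%Z = f by rewrite fE mulzK //; lia.
  have odd_f : ~~ (2 %| f)%Z.
    apply/negP => /dvdzP[h hE]; case/negP: N2; apply/dvdzP; exists h.
    by move: fE; rewrite hE PoszM; lia.
  have D2 : (2 %| Delta)%Z.
    by rewrite -(Gauss_dvdzr _ (odd_coprime _ odd_f)) -fE PoszM; exact: par.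
  move: N3; rewrite fV => /(_ D2 D2m odd_f) b1.
  have n2E : n2%:Z + 1 = k%:Z * f.
    have : Delta * (n2%:Z + 1) = Delta * (k%:Z * f).
      by rewrite e2; move: fE; rewrite PoszM; lia.
    by apply: mulfI; lia.
  have := bp b1; rewrite n1E subr0 addrC n2E mulrC.
  rewrite (Gauss_dvdzr _ (odd_coprime _ odd_f)) => k2.
  have j2 : (2 %| j%:Z)%Z.
    have -> : j%:Z = (k * m)%N%:Z - Delta by rewrite /Delta; ring.
    by apply: rpredB => //; rewrite PoszM dvdz_mulr.
  suff : (2 %| gcdn j k)%N by rewrite (eqP jk).
  by rewrite dvdn_gcd; apply/andP.
have e' : ((k * m)%N%:Z + j%:Z) * n1%:Z + Delta * (n2%:Z - 1) = 0.
  by rewrite /Delta PoszM; lia.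
have n2E : n2 = 0%N by nia.
by rewrite n2E /Delta PoszM in e' n12; nia.
Qed.

(** The map sending lh to sd and a to al preserves all multiplicative
    relations, so the resonances of the complex pair are those of a pair of
    real numbers, both of them up to sign powers of the square root of mu. *)
Lemma non_resonant_large (R : realType) (lh p mu : R) (sd al : R[i]) (m j k : nat) :
    1 < lh -> coconj lh sd -> al != 0 -> (0 < m)%N ->
    transfer lh sd p (al + al^-1) ->
    1 < mu -> mu ^+ k = lh ^+ 2 -> mu ^+ j + (mu ^+ j)^-1 = p ^+ 2 - 2 ->
    (0 < j)%N -> (0 < k)%N -> coprime j k ->
  let Delta : int := (k * m)%N%:Z - j%:Z in
  non_resonant (sd ^+ m * al) (sd ^+ m * al^-1) <->
  [/\ 2 <= Delta, ~~ (Delta %| m%:Z)%Z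
    & (2 %| Delta)%Z -> (Delta %| (2 * m)%N%:Z)%Z ->
      ~~ (2 %| ((2 * m)%N%:Z %/ Delta)%Z)%Z -> p < 0].
Proof.
move=> lh1 xy al0 m0 tp mu1 muk muj j0 k0 jk Delta.
have [nu [nu1 numu]] := real_parameter mu1 muj.
set b := (p < 0)%R; set a := (-1) ^+ b * nu ^+ j => aE.
have nu0 : nu != 0 by rewrite gt_eqF // (lt_trans _ nu1).
have lh0 : 0 < lh by apply: lt_trans lh1.
have a0 : a != 0 by rewrite mulf_neq0 ?signr_eq0 ?expf_neq0.
have sd0 := conj_neq0 lh1 xy.
have lhE : lh = nu ^+ k.
  apply/eqP; rewrite -(eqrXn2 (isT : (0 < 2)%N)) ?exprn_ge0 ?ltW ?(lt_trans _ nu1) //.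
  by rewrite -muk -numu exprAC.
have base : a ^ (2 * k)%N%:Z = lh ^ (2 * j)%N%:Z.
  rewrite lhE; apply/signed_relation => //; split=> [|_]; last first.
    by rewrite PoszM dvdz_mulr.
  by rewrite !PoszM mulrCA [k%:Z * _]mulrCA [j%:Z * k%:Z]mulrC.
(* Here be is al or its inverse, whichever satisfies the oriented relation. *)
have key (be : R[i]) : be != 0 -> transfer lh sd p (be + be^-1) ->
    be ^ (2 * k)%N%:Z = sd ^ (2 * j)%N%:Z ->
    non_resonant (sd ^+ m * be) (sd ^+ m * be^-1) <->
    non_resonant (lh ^+ m * a) (lh ^+ m * a^-1).
  move=> be0 tbe bE.
  have rel x y : a ^ x + a ^ (- x) = lh ^ y + lh ^ (- y) <->
      be ^ x + be ^ (- x) = sd ^ y + sd ^ (- y).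
    by rewrite -(relation_iff xy be0 tbe) -aE Hpoly_int.
  have k20 : (2 * k)%N%:Z != 0 by rewrite -lt0n muln_gt0 k0.
  have sdr := conj_not_root1 lh1 xy; have lhr := not_root1_gt1 lh1.
  have lhn : lh != 0 by rewrite lt0r_neq0.
  apply: non_resonant_transfer => // x y; split.
    by apply: (relation_transfer sd0 be0 lhn a0 sdr lhr bE base k20) => u v /rel.
  by apply: (relation_transfer lhn a0 sd0 be0 lhr sdr base bE k20) => u v /rel.
have -> : non_resonant (sd ^+ m * al) (sd ^+ m * al^-1) <->
    non_resonant (lh ^+ m * a) (lh ^+ m * a^-1).
  have : al ^ (2 * k)%N%:Z + al ^ (- (2 * k)%N%:Z) =
      sd ^ (2 * j)%N%:Z + sd ^ (- (2 * j)%N%:Z).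
    apply/(relation_iff xy al0 tp); rewrite -aE Hpoly_int // base.
    by rewrite -!invr_expz base.
  rewrite -!invr_expz => /addV_eq[||e|e]; rewrite ?expfz_neq0 //.
    exact: key.
  have := key al^-1; rewrite invrK => <- //; rewrite ?invr_eq0 //.
  - by split; apply: non_resonant_sym.
  - by rewrite addrC.
  - by rewrite exprz_inv -invr_expz e invrK.
rewrite -(resonance_arith (p < 0) j0 k0 m0 jk) non_resonantP //; last exact: lt0r_neq0.
rewrite lhE; split=> H n1 n2 n12; have [h1 h2] := H n1 n2 n12.
  split=> h; [apply: h1|apply: h2]; rewrite -lhE.
    by rewrite lhE; apply/signed_relation.
  by rewrite lhE; apply/signed_relation.
by split=> /signed_relation; [move/(_ nu1)/h1 | move/(_ nu1)/h2].
Qed.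

Theorem theorem6p3 (R : realType) (lambda : R) (delta sdelta alpha : R[i])
    (m : nat) (Phat P : ratfun)
    (lambda_salem : is_salem lambda)
    (delta_conj : conjugate (lambda%:C)%C delta)
    (delta_nonreal : delta \isn't Num.real)
    (m_gt0 : (0 < m)%N)
    (sdelta_sqrt : sdelta ^+ 2 = delta)
    (sdelta_conj : conjugate ((Num.sqrt lambda)%:C)%C sdelta)
    (alpha_neq0 : alpha != 0)
    (Phat_parity : if odd m then odd_ratfun Phat else even_ratfun Phat)
    (Phat_P : is_associated m Phat P)
    (Phat_regular : regular_at Phat (sdelta + sdelta^-1))
    (alpha_Phat : alpha + alpha^-1 = reval Phat (sdelta + sdelta^-1)) :
  let a1 := sdelta ^+ m * alpha in
  let a2 := sdelta ^+ m * alpha^-1 in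
  let rho := lambda + lambda^-1 in
  let rhohat := Num.sqrt lambda + (Num.sqrt lambda)^-1 in
  let Qrho := reval (Qfun m P) rho in
  (- 2 <= Qrho <= 2 ->
    (mult_dep a1 a2 <->
      exists k : nat, [/\ (0 < k)%N,
        (map_poly intr (CTpoly k)).[Qrho] = 0
        & (totient2 k %| degQ lambda)%N]) /\
    (mult_dep a1 a2 -> non_resonant a1 a2))
  /\
  (2 < Qrho ->
    let solution (j k : nat) (sigma : R) :=
      [/\ (0 < j)%N /\ (0 < k)%N, coprime j k, is_salem_trace sigma,
        (map_poly intr (Hpoly j)).[sigma] = Qrho
        & rho = (map_poly intr (Hpoly k)).[sigma]] in
    (mult_dep a1 a2 <-> exists j k sigma, solution j k sigma) /\
    (forall j k sigma j' k' sigma',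
      solution j k sigma -> solution j' k' sigma' ->
      [/\ j = j', k = k' & sigma = sigma']) /\
    (forall j k sigma, solution j k sigma ->
      let Delta : int := (k * m)%N%:Z - j%:Z in
      (non_resonant a1 a2 <->
        [/\ 2 <= Delta,
          ~~ (Delta %| m%:Z)%Z
          & ((2 %| Delta)%Z -> (Delta %| (2 * m)%N%:Z)%Z ->
             ~~ (2 %| ((2 * m)%N%:Z %/ Delta)%Z)%Z ->
             reval Phat rhohat < 0)]))).
Proof.
move=> a1 a2 rho rhohat Qrho.
have [l1 _ lV _ _] := lambda_salem; have l0 := lt_trans ltr01 l1.
pose lh := Num.sqrt lambda; have lh2 : lh ^+ 2 = lambda by rewrite sqr_sqrtr // ltW.
have lh0 : 0 < lh by rewrite sqrtr_gt0.
have lh1 : 1 < lh.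
  by rewrite ltNge; apply/negP => /(exprn_ile1 2 (ltW lh0)); rewrite lh2 leNgt l1.
have lhn : lh != 0 by rewrite lt0r_neq0.
have xy : coconj lh sdelta by apply/conjugate_real.
have t : transfer lh sdelta rhohat (sdelta + sdelta^-1).
  by apply: transferD; [|apply: transferV] => //; exact: transfer_id.
pose p := reval Phat rhohat.
have [reg tp] : regular_at Phat rhohat /\ transfer lh sdelta p (alpha + alpha^-1).
  have [reg tp] := transfer_reval (coconj_sym xy) (transfer_sym t) Phat_regular.
  by split=> //; rewrite alpha_Phat; exact: transfer_sym.
have rh0 : rhohat != 0 by rewrite lt0r_neq0 // addr_gt0 ?invr_gt0.
have rhoE : rho = rhohat ^+ 2 - 2.
  by rewrite sqrrD mulfV // exprVn addrAC addrK -/lh lh2.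
have [Qreg QE] := Qfun_reval rh0 Phat_P reg; rewrite -rhoE -/Qrho -/p in Qreg QE.
have ll : coconj lambda lambda^-1 by apply/coconj_sym/coconj_real/coconj_sym/conjugate_real.
(* The isomorphism exchanging lambda and its inverse fixes rho. *)
have tr : transfer lambda lambda^-1 rho rho.
  rewrite [X in transfer _ _ _ X](_ : rho = lambda^-1 + lambda^-1^-1).
    by apply: transferD; [|apply: transferV] => //; exact: transfer_id.
  by rewrite invrK addrC.
have rr : coconj rho rho := transfer_coconj ll tr.
(* Q(rho) is in the field generated by rho, hence a polynomial g at rho. *)
have [_ [g [gE _]]] := transfer_reval rr (transfer_id rho rho) Qreg.
have degl : degQ lambda = (2 * degQ rho)%N.
  rewrite degQ_trace ?lt0r_neq0 //.
  by rewrite gt_eqF // (lt_trans _ l1) // invf_lt1.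
have degQr : (degQ Qrho %| degQ rho)%N by rewrite /Qrho gE; exact: degQ_dvd.
split=> [Q2|Q2 solution].
  have p2 : -2 <= p <= 2 by rewrite QE in Q2; nra.
  split; last exact: (non_resonant_small lh1 xy alpha_neq0 m_gt0 tp p2).
  rewrite (mult_dep_small lh1 xy alpha_neq0 m_gt0 tp p2).
  have [b b0 bQ] := exists_addV ((Qrho%:C)%C : R[i]).
  rewrite (root1_small (p := p) b0) -?QE //.
  split=> [[N N0 bN]|[k [k0 kQ _]]].
    have [k [k0 kb kd]] := root1_CTpoly N0 bN.
    rewrite bQ -horner_intr_real in kb; rewrite bQ degQ_real in kd.
    exists k; split=> //; first exact: (fmorph_inj (real_complex R)).
    rewrite degl /totient2; case: leqP => [_|/kd ->]; first exact: dvdn_mulr.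
    by rewrite dvdn_pmul2l.
  have := @CTpoly_root1 _ k b k0 b0; rewrite bQ -horner_intr_real kQ.
  by move=> /(_ erefl).
have sal : is_salem (lh ^+ 2) by rewrite lh2.
have p2 : 2 < p ^+ 2 - 2 by rewrite -QE.
have gp : p ^+ 2 - 2 = (map_poly ratr g).[lh ^+ 2 + (lh ^+ 2)^-1].
  by rewrite lh2 -QE /Qrho gE.
have solE j k sigma : solution j k sigma <-> salem_solution lh p j k sigma.
  by rewrite /solution /salem_solution lh2 -QE.
split; [|split].
- rewrite (mult_dep_real lh1 xy alpha_neq0 m_gt0 tp) (large_relation lh1 sal p2 gp).
  by split=> -[j [k [sigma /solE s]]]; exists j, k, sigma.
- move=> j k sigma j' k' sigma' /solE s /solE s'.
  exact: (salem_solution_uniq lh1 s s').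
- move=> j k sigma /solE/(salem_solutionP lh1)[mu [mu1 _ muk muj [j0 k0 jk]]].
  exact: (non_resonant_large lh1 xy alpha_neq0 m_gt0 tp mu1 muk muj j0 k0 jk).
Qed.
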